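(* Let $q$ be a non-zero complex number which is not a root of unity, let $U^+=U_q^+(B_2)$, and let the torus $\mathcal{H}=(\mathbb{C}^* )^2$ act on $U^+$ by automorphisms via $(h_1,h_2).e_i=h_ie_i$ for $i\in\{1,2\}$. The $\mathcal{H}$-strata of $\mathrm{Spec}(U^+)$ associated to the $\mathcal{H}$-invariant prime ideals containing $z$ are $$\begin{aligned} \mathrm{Spec}_{\langle z\rangle}(U^+)&=\{\langle z\rangle\}\cup\{\langle z,z'-\beta\rangle\mid\beta\in\mathbb{C}^*\},\\ \mathrm{Spec}_{\langle e_3\rangle}(U^+)&=\{\langle e_3\rangle\},\\ \mathrm{Spec}_{\langle\overline{e_3}\rangle}(U^+)&=\{\langle\overline{e_3}\rangle\},\\ \mathrm{Spec}_{\langle e_1\rangle}(U^+)&=\{\langle e_1\rangle\}\cup\{\langle e_1,e_2-\beta\rangle\mid\beta\in\mathbb{C}^*\},\\ \mathrm{Spec}_{\langle e_2\rangle}(U^+)&=\{\langle e_2\rangle\}\cup\{\langle e_1-\alpha,e_2\rangle\mid\alpha\in\mathbb{C}^*\},\\ \mathrm{Spec}_{\langle e_1,e_2\rangle}(U^+)&=\{\langle e_1,e_2\rangle\}. \end{aligned}$$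
   Context: $U^+=U_q^+(B_2)$ is the unital associative $\mathbb{C}$-algebra generated by $e_1,e_2$ subject to the quantum Serre relations $e_1^2e_2-(q^2+q^{-2})e_1e_2e_1+e_2e_1^2=0$ and $e_2^3e_1-(q^2+1+q^{-2})e_2^2e_1e_2+(q^2+1+q^{-2})e_2e_1e_2^2-e_1e_2^3=0$. Set $e_3=e_1e_2-q^2e_2e_1$, $\overline{e_3}=e_1e_2-q^{-2}e_2e_1$, $z=e_2e_3-q^2e_3e_2$ and $z'=(1-q^{-2})\left(e_3\overline{e_3}+(1+q^{-2})ze_1\right)$; the center of $U^+$ is the polynomial ring $\mathbb{C}[z,z']$. $\langle\cdots\rangle$ denotes the two-sided ideal of $U^+$ generated by the listed elements. An ideal $I$ is $\mathcal{H}$-invariant if $h.I=I$ for all $h\in\mathcal{H}$. $\mathrm{Spec}(U^+)$ is the set of prime ideals, and for an $\mathcal{H}$-invariant prime ideal $J$ the $\mathcal{H}$-stratum is $\mathrm{Spec}_J(U^+)=\{P\in\mathrm{Spec}(U^+)\mid\bigcap_{h\in\mathcal{H}}h.P=J\}$. There are exactly eight $\mathcal{H}$-invariant prime ideals: $\langle0\rangle,\langle z\rangle,\langle z'\rangle,\langle e_3\rangle,\langle\overline{e_3}\rangle,\langle e_1\rangle,\langle e_2\rangle,\langle e_1,e_2\rangle$; all except $\langle 0\rangle$ and $\langle z'\rangle$ contain $z$. *)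

(* Defs.v *)
From HB Require Import structures.
From mathcomp Require Import all_boot all_order all_algebra.
From mathcomp Require Import boolp classical_sets reals complex.
From mathcomp Require Import ring.
From mathcomp.multinomials Require Import monalg.

Set Implicit Arguments.
Unset Strict Implicit.
Unset Printing Implicit Defensive.

Import GRing.Theory.
Local Open Scope classical_set_scope.
Local Open Scope ring_scope.
Local Open Scope quotient_scope.

Section Ideals.
Variable A : nzRingType.
Implicit Types (S I J P : set A).

Definition two_sided_ideal I : Prop :=
  [/\ I 0,
      forall x y, I x -> I y -> I (x + y),
      forall a x, I x -> I (a * x) &
      forall a x, I x -> I (x * a)].

Definition ideal_gen S : set A := smallest two_sided_ideal S.

(* The product ideal I J is contained in P iff P contains all products x * y
   with x in I and y in J. *)
Definition prime_ideal P : Prop :=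
  [/\ two_sided_ideal P, P <> [set: A] &
      forall I J, two_sided_ideal I -> two_sided_ideal J ->
        (forall x y, I x -> J y -> P (x * y)) -> I `<=` P \/ J `<=` P].

Definition Spec : set (set A) := [set P | prime_ideal P].

Lemma ideal_gen_ideal S : two_sided_ideal (ideal_gen S).
Proof.
split=> [I [[] //]|x y Ix Iy I II|a x Ix I II|a x Ix I II].
- by case: (II) => -[_ + _ _] _; apply; [apply: Ix|apply: Iy].
- by case: (II) => -[_ _ + _] _; apply; apply: Ix.
- by case: (II) => -[_ _ _ +] _; apply; apply: Ix.
Qed.

Lemma ideal_gen_sub S : S `<=` ideal_gen S.
Proof. exact: sub_gen_smallest. Qed.

Lemma ideal_gen_min S I : two_sided_ideal I -> S `<=` I -> ideal_gen S `<=` I.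
Proof. by move=> II SI x; apply. Qed.

Lemma two_sided_idealB I x y : two_sided_ideal I -> I x -> I y -> I (x - y).
Proof. by case=> _ ID IM _ Ix Iy; rewrite -mulN1r; apply/ID/IM. Qed.

End Ideals.

Section FreeAlgebra.
Variable K : fieldType.

(* Finitely supported functions from words in the letters 0, 1 to K, with the
   convolution product. *)
Definition free_alg2 : Type := {malg K[{fmonom 'I_2}]}.
HB.instance Definition _ := GRing.Lalgebra.on free_alg2.

Lemma free_alg2_scalerAr (c : K) (x y : free_alg2) :
  c *: (x * y) = x * (c *: y).
Proof.
suff cC (g : free_alg2) : g * (c%:MP : free_alg2) = (c%:MP : free_alg2) * g.
  by rewrite -!(mul_malgC c) !mulrA cC.
rewrite [g]monalgE mulr_suml mulr_sumr; apply: eq_bigr => k _.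
by rewrite !malgM_def !fgmulUU mul1m mulm1 mulrC.
Qed.
HB.instance Definition _ :=
  GRing.Lalgebra_isAlgebra.Build K free_alg2 free_alg2_scalerAr.

Definition free_gen (i : 'I_2) : free_alg2 := << fmu i >>.

Section Lift.
Variables (A : algType K) (a : 'I_2 -> A).

Definition word_eval (w : {fmonom 'I_2}) : A := \prod_(i <- (w : seq 'I_2)) a i.

Lemma word_eval_mmorphism : mmorphism word_eval.
Proof.
split=> [v w|]; first by rewrite /word_eval fmM big_cat.
by rewrite /word_eval fm1 big_nil.
Qed.
HB.instance Definition _ :=
  isMultiplicative.Build {fmonom 'I_2} A word_eval word_eval_mmorphism.

Definition free_lift : free_alg2 -> A := mmap (in_alg A) word_eval.

Lemma free_lift_zmod : zmod_morphism free_lift.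
Proof. by move=> x y; rewrite /free_lift raddfB. Qed.
HB.instance Definition _ :=
  GRing.isZmodMorphism.Build free_alg2 A free_lift free_lift_zmod.

Lemma free_lift_monoid : monoid_morphism free_lift.
Proof.
suff [] : GRing.multiplicative free_lift by split.
by apply: commr_mmap_is_multiplicative => g m m' /=; rewrite /GRing.comm mulr_algl mulr_algr.
Qed.
HB.instance Definition _ :=
  GRing.isMonoidMorphism.Build free_alg2 A free_lift free_lift_monoid.

Lemma free_lift_scalable : scalable free_lift.
Proof. by move=> c g; rewrite /free_lift mmapZ /= mulr_algl. Qed.
HB.instance Definition _ :=
  GRing.isScalable.Build K free_alg2 A *:%R free_lift free_lift_scalable.

Lemma free_lift_gen i : free_lift (free_gen i) = a i.
Proof. by rewrite /free_lift mmapU /= scale1r mul1r /word_eval fmU big_seq1. Qed.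

End Lift.
End FreeAlgebra.

Section UqB2.
Variables (K : fieldType) (q : K).

Definition serre1 (A : lalgType K) (x y : A) : A :=
  x ^+ 2 * y - (q ^+ 2 + q ^- 2) *: (x * y * x) + y * x ^+ 2.

Definition serre2 (A : lalgType K) (x y : A) : A :=
  y ^+ 3 * x - (q ^+ 2 + 1 + q ^- 2) *: (y ^+ 2 * x * y)
  + (q ^+ 2 + 1 + q ^- 2) *: (y * x * y ^+ 2) - x * y ^+ 3.

Lemma serre1_0 (A : lalgType K) : serre1 (0 : A) 0 = 0.
Proof. by rewrite /serre1 !(mulr0, mul0r, scaler0, subr0, addr0). Qed.

Lemma serre2_0 (A : lalgType K) : serre2 (0 : A) 0 = 0.
Proof. by rewrite /serre2 !(mulr0, mul0r, scaler0, subr0, addr0). Qed.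

Lemma serre1_morph (A B : lalgType K) (f : {lrmorphism A -> B}) x y :
  f (serre1 x y) = serre1 (f x) (f y).
Proof.
by rewrite /serre1 raddfD raddfB /= linearZ /= !rmorphM.
Qed.

Lemma serre2_morph (A B : lalgType K) (f : {lrmorphism A -> B}) x y :
  f (serre2 x y) = serre2 (f x) (f y).
Proof.
by rewrite /serre2 raddfB raddfD raddfB /= !linearZ /= !rmorphM.
Qed.

Local Notation F := (free_alg2 K).
Local Notation X1 := (free_gen K ord0).
Local Notation X2 := (free_gen K ord_max).

Definition serre_ideal : set F :=
  ideal_gen [set serre1 X1 X2; serre2 X1 X2].

Definition serre_idealb : {pred F} := fun x => `[< serre_ideal x >].

Lemma serre_ideal_closed : zmod_closed serre_idealb.
Proof.
have II := ideal_gen_ideal [set serre1 X1 X2; serre2 X1 X2].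
split; first by apply/asboolP; case: II.
by move=> x y /asboolP Ix /asboolP Iy; apply/asboolP; exact: (two_sided_idealB II).
Qed.
HB.instance Definition _ := GRing.isZmodClosed.Build F serre_idealb
  serre_ideal_closed.

Definition UqB2 : Type := Quotient.quot serre_idealb.
HB.instance Definition _ := GRing.Zmodule.on UqB2.

Local Notation U := UqB2.

Definition UqB2_proj (x : F) : U := \pi_(Quotient.quot serre_idealb) x.
Local Notation proj := UqB2_proj.

Lemma UqB2_projK (u : U) : proj (repr u) = u.
Proof. exact: reprK. Qed.

Lemma UqB2_projP (x y : F) : proj x = proj y <-> serre_ideal (x - y).
Proof.
split=> [/eqP|xy]; first by rewrite -[_ == _]Quotient.idealrBE => /asboolP.
by apply/eqP; rewrite -[_ == _]Quotient.idealrBE; apply/asboolP.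
Qed.

Lemma UqB2_proj_repr (x : F) : serre_ideal (repr (proj x) - x).
Proof. by apply/UqB2_projP; rewrite UqB2_projK. Qed.

Lemma UqB2_proj_zmod : zmod_morphism proj.
Proof. exact: (raddfB \pi_(Quotient.quot serre_idealb)). Qed.
HB.instance Definition _ := GRing.isZmodMorphism.Build F U proj UqB2_proj_zmod.

(* Every relation is of positive degree, so 1 is not in the ideal. *)
Lemma serre_ideal1 : ~ serre_ideal 1.
Proof.
have [eps epsX] : exists eps : {lrmorphism F -> K^o},
    forall i, eps (free_gen K i) = 0.
  by exists (free_lift (fun=> 0 : K^o)) => i; exact: free_lift_gen.
suff epsI : [set M | two_sided_ideal M /\
    [set serre1 X1 X2; serre2 X1 X2] `<=` M] [set x | eps x = 0].
  by move=> /(_ _ epsI)/eqP; rewrite rmorph1 oner_eq0.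
split.
  split=> [|x y /= ex ey|a x /= ex|a x /= ex].
  - by rewrite /= raddf0.
  - by rewrite raddfD /= ex ey addr0.
  - by rewrite rmorphM /= ex mulr0.
  - by rewrite rmorphM /= ex mul0r.
move=> x [->|->] /=.
  by rewrite serre1_morph !epsX serre1_0.
by rewrite serre2_morph !epsX serre2_0.
Qed.

Definition UqB2_one : U := proj 1.
Definition UqB2_mul (u v : U) : U := proj (repr u * repr v).
Definition UqB2_scale (c : K) (u : U) : U := proj (c *: repr u).

Lemma UqB2_projM x y : UqB2_mul (proj x) (proj y) = proj (x * y).
Proof.
apply/UqB2_projP; have [_ ID IMl IMr] := ideal_gen_ideal [set serre1 X1 X2; serre2 X1 X2].
rewrite -[_ * _](subrK (x * repr (proj y))) -mulrBl -addrA -mulrBr.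
by apply: ID; [apply: IMr|apply: IMl]; apply: UqB2_proj_repr.
Qed.

Lemma UqB2_projZ c x : UqB2_scale c (proj x) = proj (c *: x).
Proof.
apply/UqB2_projP; have [_ _ IMl _] := ideal_gen_ideal [set serre1 X1 X2; serre2 X1 X2].
by rewrite -scalerBr -mulr_algl; apply: IMl; apply: UqB2_proj_repr.
Qed.

Lemma UqB2_mulA : associative UqB2_mul.
Proof.
move=> u v w; rewrite -(UqB2_projK u) -(UqB2_projK v) -(UqB2_projK w).
by rewrite !UqB2_projM mulrA.
Qed.
Lemma UqB2_mul1r : left_id UqB2_one UqB2_mul.
Proof. by move=> u; rewrite -(UqB2_projK u) UqB2_projM mul1r. Qed.
Lemma UqB2_mulr1 : right_id UqB2_one UqB2_mul.
Proof. by move=> u; rewrite -(UqB2_projK u) UqB2_projM mulr1. Qed.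
Lemma UqB2_mulDl : left_distributive UqB2_mul +%R.
Proof.
move=> u v w; rewrite -(UqB2_projK u) -(UqB2_projK v) -(UqB2_projK w).
by rewrite -raddfD !UqB2_projM mulrDl raddfD.
Qed.
Lemma UqB2_mulDr : right_distributive UqB2_mul +%R.
Proof.
move=> u v w; rewrite -(UqB2_projK u) -(UqB2_projK v) -(UqB2_projK w).
by rewrite -raddfD !UqB2_projM mulrDr raddfD.
Qed.
Lemma UqB2_one_neq0 : UqB2_one != 0.
Proof.
apply/eqP; rewrite -(raddf0 proj) => /UqB2_projP; rewrite subr0.
exact: serre_ideal1.
Qed.
HB.instance Definition _ := GRing.Zmodule_isNzRing.Build U
  UqB2_mulA UqB2_mul1r UqB2_mulr1 UqB2_mulDl UqB2_mulDr UqB2_one_neq0.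

Lemma UqB2_scalerA (a b : K) (u : U) :
  UqB2_scale a (UqB2_scale b u) = UqB2_scale (a * b) u.
Proof. by rewrite -(UqB2_projK u) !UqB2_projZ scalerA. Qed.
Lemma UqB2_scale1r : left_id 1 UqB2_scale.
Proof. by move=> u; rewrite -(UqB2_projK u) UqB2_projZ scale1r. Qed.
Lemma UqB2_scalerDr : right_distributive UqB2_scale +%R.
Proof.
move=> a u v; rewrite -(UqB2_projK u) -(UqB2_projK v).
by rewrite -raddfD !UqB2_projZ scalerDr raddfD.
Qed.
Lemma UqB2_scalerDl (u : U) : {morph UqB2_scale^~ u : a b / a + b}.
Proof.
by move=> a b; rewrite -(UqB2_projK u) !UqB2_projZ scalerDl raddfD.
Qed.
HB.instance Definition _ := GRing.Zmodule_isLmodule.Build K U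
  UqB2_scalerA UqB2_scale1r UqB2_scalerDr UqB2_scalerDl.

Lemma UqB2_scalerAl (a : K) (u v : U) : a *: (u * v) = (a *: u) * v.
Proof.
rewrite -(UqB2_projK u) -(UqB2_projK v).
by rewrite /GRing.mul /= /GRing.scale /= !(UqB2_projZ, UqB2_projM) scalerAl.
Qed.
HB.instance Definition _ := GRing.Lmodule_isLalgebra.Build K U UqB2_scalerAl.

Lemma UqB2_scalerAr (a : K) (u v : U) : a *: (u * v) = u * (a *: v).
Proof.
rewrite -(UqB2_projK u) -(UqB2_projK v).
by rewrite /GRing.mul /= /GRing.scale /= !(UqB2_projZ, UqB2_projM) scalerAr.
Qed.
HB.instance Definition _ := GRing.Lalgebra_isAlgebra.Build K U UqB2_scalerAr.

Lemma UqB2_proj_monoid : monoid_morphism proj.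
Proof. by split=> // x y; rewrite -UqB2_projM. Qed.
HB.instance Definition _ :=
  GRing.isMonoidMorphism.Build F U proj UqB2_proj_monoid.

Lemma UqB2_proj_scalable : scalable proj.
Proof. by move=> c x; rewrite -UqB2_projZ. Qed.
HB.instance Definition _ :=
  GRing.isScalable.Build K F U *:%R proj UqB2_proj_scalable.

Definition e1 : U := proj X1.
Definition e2 : U := proj X2.

Lemma serre1_e : serre1 e1 e2 = 0.
Proof.
rewrite -(serre1_morph proj) -[RHS](raddf0 proj); apply/UqB2_projP.
by rewrite subr0; apply: ideal_gen_sub; left.
Qed.

Lemma serre2_e : serre2 e1 e2 = 0.
Proof.
rewrite -(serre2_morph proj) -[RHS](raddf0 proj); apply/UqB2_projP.
by rewrite subr0; apply: ideal_gen_sub; right.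
Qed.

Section UniversalProperty.
Variables (A : algType K) (x y : A).

(* A morphism as soon as x and y satisfy the two relations, which is assumed
   below but not in the definition. *)
Definition UqB2_lift (u : U) : A :=
  free_lift (fun i => if i == ord0 then x else y) (repr u).

Hypotheses (xy1 : serre1 x y = 0) (xy2 : serre2 x y = 0).

Lemma UqB2_lift_proj f :
  UqB2_lift (proj f) = free_lift (fun i => if i == ord0 then x else y) f.
Proof.
rewrite /UqB2_lift.
have [phi phiE] : exists phi : {lrmorphism F -> A},
    phi =1 free_lift (fun i => if i == ord0 then x else y).
  by exists (free_lift (fun i => if i == ord0 then x else y)).
rewrite -!phiE; apply/eqP; rewrite -subr_eq0 -raddfB /=; apply/eqP.
have := UqB2_proj_repr f; apply: (@ideal_gen_min _ _ [set g | phi g = 0]).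
  split=> [|u v /= eu ev|a u /= eu|a u /= eu].
  - by rewrite /= raddf0.
  - by rewrite raddfD /= eu ev addr0.
  - by rewrite rmorphM /= eu mulr0.
  - by rewrite rmorphM /= eu mul0r.
have phi1 : phi X1 = x by rewrite phiE free_lift_gen.
have phi2 : phi X2 = y by rewrite phiE free_lift_gen.
by move=> u [->|->] /=; rewrite (serre1_morph, serre2_morph) phi1 phi2.
Qed.

Lemma UqB2_lift_e1 : UqB2_lift e1 = x.
Proof. by rewrite UqB2_lift_proj free_lift_gen. Qed.

Lemma UqB2_lift_e2 : UqB2_lift e2 = y.
Proof. by rewrite UqB2_lift_proj free_lift_gen. Qed.

Lemma UqB2_lift_zmod : zmod_morphism UqB2_lift.
Proof.
move=> u v; rewrite -(UqB2_projK u) -(UqB2_projK v) -raddfB /=.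
by rewrite !UqB2_lift_proj raddfB.
Qed.

Lemma UqB2_lift_monoid : monoid_morphism UqB2_lift.
Proof.
split=> [|u v]; first by rewrite -(rmorph1 proj) UqB2_lift_proj rmorph1.
rewrite -(UqB2_projK u) -(UqB2_projK v) -rmorphM /=.
by rewrite !UqB2_lift_proj rmorphM.
Qed.

Lemma UqB2_lift_scalable : scalable UqB2_lift.
Proof.
move=> c u; rewrite -(UqB2_projK u) -linearZ /=.
by rewrite !UqB2_lift_proj linearZ.
Qed.

End UniversalProperty.

Lemma UqB2_morph_ext (A : algType K) (f g : {lrmorphism U -> A}) :
  f e1 = g e1 -> f e2 = g e2 -> f =1 g.
Proof.
move=> fg1 fg2 u; rewrite -(UqB2_projK u); move: (repr u) => w.
have fgX i : f (proj (free_gen K i)) = g (proj (free_gen K i)).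
  have [->|->] // : i = ord0 \/ i = ord_max.
  by case: i => -[|[|//]] ?; [left|right]; apply: val_inj.
have fgW (s : seq 'I_2) : f (proj << FMonom s >>) = g (proj << FMonom s >>).
  elim: s => [|i s IHs].
    by rewrite -fmoneE -[X in proj X]/(1 : F) !rmorph1.
  have -> : << FMonom (i :: s) >> = free_gen K i * << FMonom s >> :> F.
    by rewrite /free_gen malgM_def fgmulUU mul1r /mmul /= fmmulE fmuE.
  by rewrite !rmorphM /= fgX IHs.
rewrite [w]monalgE !raddf_sum /=; apply: eq_bigr => k _.
have -> : << w@_k *g k >> = w@_k *: << FMonom k >> :> F.
  by rewrite fmK -mul_malgC malgM_def fgmulUU mulr1 mul1m.
by rewrite !linearZ /= fgW.
Qed.

Definition e3 : U := e1 * e2 - q ^+ 2 *: (e2 * e1).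
Definition e3bar : U := e1 * e2 - q ^- 2 *: (e2 * e1).
Definition z : U := e2 * e3 - q ^+ 2 *: (e3 * e2).
Definition z' : U :=
  (1 - q ^- 2) *: (e3 * e3bar + (1 + q ^- 2) *: (z * e1)).

Definition torus : set (K * K) := [set h | h.1 != 0 /\ h.2 != 0].

(* The action of h = (h_1, h_2): see act_e1, act_e2, act1 and actM below. *)
Definition act (h : K * K) : U -> U := UqB2_lift (h.1 *: e1) (h.2 *: e2).

Lemma serre1_scale (A : algType K) (a b : K) (x y : A) :
  serre1 (a *: x) (b *: y) = (a ^+ 2 * b) *: serre1 x y.
Proof.
rewrite /serre1 !exprZn !(scalerDr, scalerN).
rewrite -!(scalerAl, scalerAr) !scalerA.
by congr (_ *: _ - _ *: _ + _ *: _); ring.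
Qed.

Lemma serre2_scale (A : algType K) (a b : K) (x y : A) :
  serre2 (a *: x) (b *: y) = (a * b ^+ 3) *: serre2 x y.
Proof.
rewrite /serre2 !exprZn !(scalerDr, scalerN).
rewrite -!(scalerAl, scalerAr) !scalerA.
by congr (_ *: _ - _ *: _ + _ *: _ - _ *: _); ring.
Qed.

Lemma serre1_act (h : K * K) : serre1 (h.1 *: e1) (h.2 *: e2) = 0.
Proof. by rewrite serre1_scale serre1_e scaler0. Qed.

Lemma serre2_act (h : K * K) : serre2 (h.1 *: e1) (h.2 *: e2) = 0.
Proof. by rewrite serre2_scale serre2_e scaler0. Qed.

HB.instance Definition _ h := GRing.isZmodMorphism.Build U U (act h)
  (UqB2_lift_zmod (serre1_act h) (serre2_act h)).
HB.instance Definition _ h := GRing.isMonoidMorphism.Build U U (act h)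
  (UqB2_lift_monoid (serre1_act h) (serre2_act h)).
HB.instance Definition _ h := GRing.isScalable.Build K U U *:%R (act h)
  (UqB2_lift_scalable (serre1_act h) (serre2_act h)).

Lemma act_e1 h : act h e1 = h.1 *: e1.
Proof. exact: UqB2_lift_e1 (serre1_act h) (serre2_act h). Qed.

Lemma act_e2 h : act h e2 = h.2 *: e2.
Proof. exact: UqB2_lift_e2 (serre1_act h) (serre2_act h). Qed.

Lemma act1 u : act (1, 1) u = u.
Proof.
by apply: (UqB2_morph_ext (f := act _) (g := idfun)) => /=;
  rewrite (act_e1, act_e2) scale1r.
Qed.

Lemma actM h k u : act h (act k u) = act (h.1 * k.1, h.2 * k.2) u.
Proof.
by apply: (UqB2_morph_ext (f := act h \o act k) (g := act _)) => /=;
  rewrite !(act_e1, act_e2) linearZ /= !(act_e1, act_e2) scalerA mulrC.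
Qed.

Definition stratum (J : set U) : set (set U) :=
  [set P | Spec P /\ \bigcap_(h in torus) (act h @` P) = J].

End UqB2.

(* Main.v *)
From HB Require Import structures.
Require Import Defs.
From mathcomp Require Import all_boot all_order all_algebra.
From mathcomp Require Import boolp classical_sets functions reals complex.
From mathcomp Require Import ring.
From mathcomp.multinomials Require Import monalg.

(* Put x = e1, y = e2, a = e3, b = e3bar.  Modulo z the elements a and b commute,
   x and y commute with each of them up to powers of q^2, and yx and xy are linear
   combinations of a and b; so U / <z> is spanned by the products p(z') m n with
   p a polynomial, m a power of a or of b and n a power of x or of y.  Let I be a
   proper ideal containing z such that a or b is regular modulo I.  As q is not a
   root of unity, commuting an element of I with a or b, and then with x or y,
   separates its components p(z') m n, and multiplying by y on both sides removes
   the factor n (the determinant q^(2k) - q^(-2k) is not zero); hence every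
   p(z') m is in I.
   - If e3 is in I and e3bar is regular, this gives I = <e3>, and similarly for
     e3bar.  Together with a saturation argument this shows that <e3> is prime.
   - If a and b are regular, every p(z') is in I.  Thus <z, z' - g> is maximal for
     g <> 0, the intersection of these ideals is <z>, and a prime of the stratum
     of <z>, which contains neither a nor b, is <z> or one of them.
   The ideals <e1> and <e2> are handled like <z>, the quotients being polynomial
   rings.  That <z, z' - g> is proper, and that a and b are not nilpotent modulo
   <e3bar> and <e3>, is seen by letting U act on the functions on the integers,
   x as the shift and y as a weighted inverse shift. *)

Set Implicit Arguments.
Unset Strict Implicit.
Unset Printing Implicit Defensive.

Import Order.TTheory GRing.Theory Num.Theory.
Local Open Scope classical_set_scope.
Local Open Scope ring_scope.

(** * Quotients of algebras by two-sided ideals *)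

Section QuotientAlgebra.
Variables (K : fieldType) (A : algType K) (I : set A).
Hypotheses (II : two_sided_ideal I) (I1 : ~ I 1).

Definition memb_ideal of ~ I 1 & two_sided_ideal I : {pred A} :=
  fun x => `[< I x >].
Local Notation Ib := (memb_ideal I1 II).

Lemma memb_ideal_closed : zmod_closed Ib.
Proof.
split; first by apply/asboolP; case: II.
by move=> x y /asboolP Ix /asboolP Iy; apply/asboolP; exact: two_sided_idealB.
Qed.
HB.instance Definition _ := GRing.isZmodClosed.Build A Ib memb_ideal_closed.

Definition quot_alg : Type := Quotient.quot Ib.
HB.instance Definition _ := GRing.Zmodule.on quot_alg.

Definition quot_proj (x : A) : quot_alg := \pi_(Quotient.quot Ib)%qT x.
Local Notation Q := quot_alg.
Local Notation pi := quot_proj.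

Lemma quot_projK (u : Q) : pi (repr u) = u.
Proof. exact: reprK. Qed.

Lemma quot_projP (x y : A) : pi x = pi y <-> I (x - y).
Proof.
split=> [/eqP|xy]; first by rewrite -[_ == _]Quotient.idealrBE => /asboolP.
by apply/eqP; rewrite -[_ == _]Quotient.idealrBE; apply/asboolP.
Qed.

Lemma quot_proj_zmod : zmod_morphism pi.
Proof. exact: (raddfB \pi_(Quotient.quot Ib)%qT). Qed.
HB.instance Definition _ := GRing.isZmodMorphism.Build A Q pi quot_proj_zmod.

Definition quot_mul (u v : Q) : Q := pi (repr u * repr v).
Definition quot_scale (c : K) (u : Q) : Q := pi (c *: repr u).

Lemma quot_projM x y : quot_mul (pi x) (pi y) = pi (x * y).
Proof.
apply/quot_projP; have [_ ID IMl IMr] := II.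
rewrite -[_ * _](subrK (x * repr (pi y))) -mulrBl -addrA -mulrBr.
by apply: ID; [apply: IMr|apply: IMl]; apply/quot_projP; rewrite quot_projK.
Qed.

Lemma quot_projZ c x : quot_scale c (pi x) = pi (c *: x).
Proof.
apply/quot_projP; have [_ _ IMl _] := II.
by rewrite -scalerBr -mulr_algl; apply/IMl/quot_projP; rewrite quot_projK.
Qed.

Let elim_quot (P : Q -> Prop) : (forall x, P (pi x)) -> forall u, P u.
Proof. by move=> Ppi u; rewrite -(quot_projK u). Qed.

Lemma quot_mulA : associative quot_mul.
Proof.
by do 3!elim/elim_quot=> ?; rewrite !quot_projM mulrA.
Qed.
Lemma quot_mul1r : left_id (pi 1) quot_mul.
Proof. by elim/elim_quot=> x; rewrite quot_projM mul1r. Qed.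
Lemma quot_mulr1 : right_id (pi 1) quot_mul.
Proof. by elim/elim_quot=> x; rewrite quot_projM mulr1. Qed.
Lemma quot_mulDl : left_distributive quot_mul +%R.
Proof.
by do 3!elim/elim_quot=> ?; rewrite -raddfD !quot_projM mulrDl raddfD.
Qed.
Lemma quot_mulDr : right_distributive quot_mul +%R.
Proof.
by do 3!elim/elim_quot=> ?; rewrite -raddfD !quot_projM mulrDr raddfD.
Qed.
Lemma quot_one_neq0 : pi 1 != 0.
Proof. by apply/eqP; rewrite -(raddf0 pi) => /quot_projP; rewrite subr0. Qed.
HB.instance Definition _ := GRing.Zmodule_isNzRing.Build Q
  quot_mulA quot_mul1r quot_mulr1 quot_mulDl quot_mulDr quot_one_neq0.

Lemma quot_scalerA (a b : K) (u : Q) :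
  quot_scale a (quot_scale b u) = quot_scale (a * b) u.
Proof. by elim/elim_quot: u => x; rewrite !quot_projZ scalerA. Qed.
Lemma quot_scale1r : left_id 1 quot_scale.
Proof. by elim/elim_quot=> x; rewrite quot_projZ scale1r. Qed.
Lemma quot_scalerDr : right_distributive quot_scale +%R.
Proof.
by move=> a; do 2!elim/elim_quot=> ?; rewrite -raddfD !quot_projZ scalerDr raddfD.
Qed.
Lemma quot_scalerDl (u : Q) : {morph quot_scale^~ u : a b / a + b}.
Proof.
by move=> a b; elim/elim_quot: u => x; rewrite !quot_projZ scalerDl raddfD.
Qed.
HB.instance Definition _ := GRing.Zmodule_isLmodule.Build K Q
  quot_scalerA quot_scale1r quot_scalerDr quot_scalerDl.

Lemma quot_scalerAl (a : K) (u v : Q) : a *: (u * v) = (a *: u) * v.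
Proof.
elim/elim_quot: u => x; elim/elim_quot: v => y.
by rewrite /GRing.mul /= /GRing.scale /= !(quot_projZ, quot_projM) scalerAl.
Qed.
HB.instance Definition _ := GRing.Lmodule_isLalgebra.Build K Q quot_scalerAl.

Lemma quot_scalerAr (a : K) (u v : Q) : a *: (u * v) = u * (a *: v).
Proof.
elim/elim_quot: u => x; elim/elim_quot: v => y.
by rewrite /GRing.mul /= /GRing.scale /= !(quot_projZ, quot_projM) scalerAr.
Qed.
HB.instance Definition _ := GRing.Lalgebra_isAlgebra.Build K Q quot_scalerAr.

Lemma quot_proj_monoid : monoid_morphism pi.
Proof. by split=> // x y; rewrite -quot_projM. Qed.
HB.instance Definition _ :=
  GRing.isMonoidMorphism.Build A Q pi quot_proj_monoid.

Lemma quot_proj_scalable : scalable pi.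
Proof. by move=> c x; rewrite -quot_projZ. Qed.
HB.instance Definition _ :=
  GRing.isScalable.Build K A Q *:%R pi quot_proj_scalable.

Lemma ideal_quotient :
  exists (B : algType K) (p : {lrmorphism A -> B}),
    (forall u, exists x, p x = u) /\ forall x, p x = 0 <-> I x.
Proof.
exists Q, pi; split=> [u|x]; first by exists (repr u); apply: quot_projK.
by rewrite -(raddf0 pi) quot_projP subr0.
Qed.

End QuotientAlgebra.

(** * Linear operators on sequences indexed by the integers *)

Section SequenceOperators.
Variable K : fieldType.
Local Notation V := (int -> K^o).

Record seqop := SeqOp { seqop_fun :> V -> V; seqop_linear : linear seqop_fun }.
HB.instance Definition _ := gen_eqMixin seqop.
HB.instance Definition _ := gen_choiceMixin seqop.

Lemma seqopP (S T : seqop) : S =1 T -> S = T.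
Proof.
case: S T => [S lS] [T lT] /= /funext ST; rewrite ST in lS *.
by rewrite (Prop_irrelevance lS lT).
Qed.

Lemma seqop_linD (S : seqop) : {morph S : f g / f + g}.
Proof. by move=> f g; have := seqop_linear S 1 f g; rewrite !scale1r. Qed.
Lemma seqop_lin0 (S : seqop) : S 0 = 0.
Proof. by apply: (addrI (S 0)); rewrite -seqop_linD !addr0. Qed.
Lemma seqop_linZ (S : seqop) c f : S (c *: f) = c *: S f.
Proof. by have := seqop_linear S c f 0; rewrite seqop_lin0 !addr0. Qed.

Lemma seqop_add_subproof (S T : seqop) : linear (fun f => S f + T f).
Proof. by move=> c f g; rewrite !seqop_linear scalerDr addrACA. Qed.
Lemma seqop_mul_subproof (S T : seqop) : linear (S \o T).
Proof. by move=> c f g; rewrite /= !seqop_linear. Qed.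
Lemma seqop_scale_subproof (a : K) (S : seqop) : linear (fun f => a *: S f).
Proof. by move=> c f g; rewrite seqop_linear scalerDr !scalerA mulrC. Qed.
Lemma seqop_zero_subproof : linear (fun _ : V => 0 : V).
Proof. by move=> c f g; rewrite scaler0 addr0. Qed.
Lemma seqop_one_subproof : linear (id : V -> V).
Proof. by []. Qed.

Definition seqop_add S T := SeqOp (seqop_add_subproof S T).
Definition seqop_mul S T := SeqOp (seqop_mul_subproof S T).
Definition seqop_scale a S := SeqOp (seqop_scale_subproof a S).
Definition seqop_zero := SeqOp seqop_zero_subproof.
Definition seqop_one := SeqOp seqop_one_subproof.

Fact seqop_addA : associative seqop_add.
Proof. by move=> S T U; apply: seqopP => f; apply: addrA. Qed.
Fact seqop_addC : commutative seqop_add.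
Proof. by move=> S T; apply: seqopP => f; apply: addrC. Qed.
Fact seqop_add0 : left_id seqop_zero seqop_add.
Proof. by move=> S; apply: seqopP => f; apply: add0r. Qed.
Fact seqop_addN : left_inverse seqop_zero (seqop_scale (-1)) seqop_add.
Proof. by move=> S; apply: seqopP => f /=; rewrite scaleN1r addNr. Qed.
HB.instance Definition _ :=
  GRing.isZmodule.Build seqop seqop_addA seqop_addC seqop_add0 seqop_addN.

Fact seqop_mulA : associative seqop_mul.
Proof. by move=> S T U; apply: seqopP. Qed.
Fact seqop_mul1 : left_id seqop_one seqop_mul.
Proof. by move=> S; apply: seqopP. Qed.
Fact seqop_1mul : right_id seqop_one seqop_mul.
Proof. by move=> S; apply: seqopP. Qed.
Fact seqop_mulDl : left_distributive seqop_mul +%R.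
Proof. by move=> S T U; apply: seqopP. Qed.
Fact seqop_mulDr : right_distributive seqop_mul +%R.
Proof. by move=> S T U; apply: seqopP => f; apply: seqop_linD. Qed.
Fact seqop_one_neq0 : seqop_one != 0.
Proof.
apply/eqP => /(congr1 (fun S : seqop => S (fun=> 1) 0)) /eqP.
by rewrite /= oner_eq0.
Qed.
HB.instance Definition _ := GRing.Zmodule_isNzRing.Build seqop
  seqop_mulA seqop_mul1 seqop_1mul seqop_mulDl seqop_mulDr seqop_one_neq0.

Fact seqop_scalerA (a b : K) (S : seqop) :
  seqop_scale a (seqop_scale b S) = seqop_scale (a * b) S.
Proof. by apply: seqopP => f; apply: scalerA. Qed.
Fact seqop_scale1r : left_id 1 seqop_scale.
Proof. by move=> S; apply: seqopP => f; apply: scale1r. Qed.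
Fact seqop_scalerDr : right_distributive seqop_scale +%R.
Proof. by move=> a S T; apply: seqopP => f; apply: scalerDr. Qed.
Fact seqop_scalerDl (S : seqop) : {morph seqop_scale^~ S : a b / a + b}.
Proof. by move=> a b; apply: seqopP => f; apply: scalerDl. Qed.
HB.instance Definition _ := GRing.Zmodule_isLmodule.Build K seqop
  seqop_scalerA seqop_scale1r seqop_scalerDr seqop_scalerDl.

Fact seqop_scalerAl (a : K) (S T : seqop) : a *: (S * T) = (a *: S) * T.
Proof. exact: seqopP. Qed.
HB.instance Definition _ := GRing.Lmodule_isLalgebra.Build K seqop seqop_scalerAl.
Fact seqop_scalerAr (a : K) (S T : seqop) : a *: (S * T) = S * (a *: T).
Proof. by apply: seqopP => f; rewrite [LHS]/= [RHS]/= -seqop_linZ. Qed.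
HB.instance Definition _ := GRing.Lalgebra_isAlgebra.Build K seqop seqop_scalerAr.

Lemma seqop_eq_at (S T : seqop) : (forall f n, S f n = T f n) -> S = T.
Proof. by move=> ST; apply: seqopP => f; apply/funext => n; apply: ST. Qed.

Lemma seqopD (S T : seqop) f n : (S + T) f n = S f n + T f n. Proof. by []. Qed.
Lemma seqopN (S : seqop) f n : (- S) f n = - S f n.
Proof. by rewrite -[LHS]/(- 1 * S f n) mulN1r. Qed.
Lemma seqopZ a (S : seqop) f n : (a *: S) f n = a * S f n. Proof. by []. Qed.
Lemma seqopM (S T : seqop) f : (S * T) f = S (T f). Proof. by []. Qed.
Lemma seqop1 f : (1 : seqop) f = f. Proof. by []. Qed.
Lemma seqop0 f n : (0 : seqop) f n = 0. Proof. by []. Qed.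

Lemma mulshift_linear (g : int -> K) (d : int) :
  linear (fun (f : V) n => g n * f (n + d) : K^o).
Proof. by move=> c f h; apply/funext=> n /=; rewrite !fctE /= scalerAr -mulrDr. Qed.
Definition mulshift g d := SeqOp (mulshift_linear g d).

Lemma mulshiftE g d f n : mulshift g d f n = g n * f (n + d). Proof. by []. Qed.

End SequenceOperators.

(** * Commutation relations *)

(* Turns a linear identity between three vectors into three identities between
   scalars, to which the tactics for commutative rings apply. *)
Lemma lincomb3 (K : fieldType) (V : lmodType K) (v1 v2 v3 : V) :
  exists L : K -> K -> K -> V,
    [/\ v1 = L 1 0 0, v2 = L 0 1 0, v3 = L 0 0 1 &
        [/\ forall a b c a' b' c', L a b c + L a' b' c' = L (a + a') (b + b') (c + c'),
            forall a b c, - L a b c = L (- a) (- b) (- c),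
            forall k a b c, k *: L a b c = L (k * a) (k * b) (k * c) &
            L 0 0 0 = 0]].
Proof.
exists (fun a b c => a *: v1 + b *: v2 + c *: v3).
split; rewrite ?scale0r ?scale1r ?addr0 ?add0r //.
split=> [*|*|*|]; rewrite ?scale0r ?addr0 //.
- by rewrite !scalerDl [LHS]addrACA; congr (_ + _); rewrite addrACA.
- by rewrite !opprD !scaleNr.
- by rewrite !scalerDr !scalerA.
Qed.

(* The relations of U / <z> with u = e1, v = e2, a = e3, b = e3bar, and r = q^2;
   the scalars c1 and c2 make them stable under the exchange of u and v. *)
Record weyl_rel (K : fieldType) (A : algType K) (r c1 c2 : K) (u v a b : A) := WeylRel {
  weyl_ua : u * a = r^-1 *: (a * u);
  weyl_ub : u * b = r *: (b * u);
  weyl_va : v * a = r *: (a * v);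
  weyl_vb : v * b = r^-1 *: (b * v);
  weyl_vu : v * u = c1 *: b - c2 *: a;
  weyl_uv : u * v = (c1 * r) *: b - (c2 * r^-1) *: a;
  weyl_ab : a * b = b * a
}.

Lemma weyl_rel_sym (K : fieldType) (A : algType K) (r c1 c2 : K) (u v a b : A) :
  r != 0 -> weyl_rel r c1 c2 u v a b -> weyl_rel r^-1 (c1 * r) (c2 / r) v u a b.
Proof.
by move=> r0 [? ? ? ? ? ? ?]; split; rewrite ?invrK ?mulfK ?mulfVK.
Qed.

Lemma rmorph_qcomm (K : fieldType) (A B : algType K) (f : {lrmorphism A -> B})
    (c : K) (x y : A) :
  f (x * y - c *: (y * x)) = f x * f y - c *: (f y * f x).
Proof. by rewrite raddfB /= linearZ /= !rmorphM. Qed.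

Lemma rmorph_z' (K : fieldType) (A B : algType K) (f : {lrmorphism A -> B})
    (c d : K) (a b t x : A) :
  f t = 0 -> f (c *: (a * b + d *: (t * x))) = c *: (f a * f b).
Proof.
move=> ft; rewrite linearZ raddfD /= linearZ /= !rmorphM /= ft.
by rewrite mul0r scaler0 addr0.
Qed.

Section Relations.
Variables (K : fieldType) (q : K).
Hypotheses (q0 : q != 0) (q4 : q ^+ 4 != 1).

Lemma q2_neq_q2V : q ^+ 2 - q ^- 2 != 0.
Proof.
apply: contra_neq q4 => /eqP; rewrite subr_eq0 => /eqP h.
by rewrite -[RHS](mulfV (expf_neq0 2 q0)) -h -exprD.
Qed.


Section Identities.
Variables (A : algType K) (x y : A).
Let a := x * y - q ^+ 2 *: (y * x).
Let b := x * y - q ^- 2 *: (y * x).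
Let expand := (mulrDl, mulrDr, mulNr, mulrN, opprD, @opprK A, scalerDr, scalerN,
  scalerA, mulrA).

Lemma serre1_e3 : x * a = q ^- 2 *: (a * x) + serre1 q x y.
Proof.
rewrite /serre1 /a !expr2 !expand -!scalerAl -!scalerAr !expand.
have [L [-> -> -> [LD LN LZ L0]]] :=
  lincomb3 (x * x * y) (x * y * x) (y * x * x).
by rewrite !(LZ, LN, LD); congr (L _ _ _); field.
Qed.

Lemma serre1_e3bar : x * b = q ^+ 2 *: (b * x) + serre1 q x y.
Proof.
rewrite /serre1 /b !expr2 !expand -!scalerAl -!scalerAr !expand.
have [L [-> -> -> [LD LN LZ L0]]] :=
  lincomb3 (x * x * y) (x * y * x) (y * x * x).
by rewrite !(LZ, LN, LD); congr (L _ _ _); field.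
Qed.

Lemma z_e3bar :
  y * b = q ^- 2 *: (b * y) + q ^- 4 *: (y * a - q ^+ 2 *: (a * y)).
Proof.
rewrite /a /b !expand -!scalerAl -!scalerAr !expand.
have [L [-> -> -> [LD LN LZ L0]]] :=
  lincomb3 (x * y * y) (y * x * y) (y * y * x).
by rewrite !(LZ, LN, LD); congr (L _ _ _); field.
Qed.

Lemma e3bar_sub_e3 : b - a = (q ^+ 2 - q ^- 2) *: (y * x).
Proof.
rewrite /a /b !expand.
have [L [-> -> _ [LD LN LZ L0]]] := lincomb3 (x * y) (y * x) 0.
by rewrite !(LZ, LN, LD); congr (L _ _ _); field.
Qed.

Lemma e3bar_sub_e3_twisted :
  q ^+ 2 *: b - q ^- 2 *: a = (q ^+ 2 - q ^- 2) *: (x * y).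
Proof.
rewrite /a /b !expand.
have [L [-> -> _ [LD LN LZ L0]]] := lincomb3 (x * y) (y * x) 0.
by rewrite !(LZ, LN, LD); congr (L _ _ _); field.
Qed.

Let c := (q ^+ 2 - q ^- 2)^-1.

Lemma serre_weyl_rel : serre1 q x y = 0 -> y * a = q ^+ 2 *: (a * y) ->
  weyl_rel (q ^+ 2) c c x y a b.
Proof.
move=> s1 ya; have c0 := q2_neq_q2V.
have xa : x * a = q ^- 2 *: (a * x) by rewrite serre1_e3 s1 addr0.
have yx : y * x = c *: b - c *: a.
  by rewrite -scalerBr e3bar_sub_e3 scalerA mulVf // scale1r.
split=> //.
- by rewrite serre1_e3bar s1 addr0.
- by rewrite z_e3bar ya subrr scaler0 addr0.
- rewrite -[_ *: b]scalerA -[_ *: a]scalerA -scalerBr e3bar_sub_e3_twisted.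
  by rewrite scalerA mulVf // scale1r.
have ba := e3bar_sub_e3; rewrite -/a -/b in ba; clearbody a b.
have yxa : y * x * a = a * (y * x).
  rewrite -mulrA xa -scalerAr [y * (a * x)]mulrA ya -scalerAl scalerA.
  by rewrite mulVf ?expf_neq0 // scale1r mulrA.
have -> : b = (q ^+ 2 - q ^- 2) *: (y * x) + a by rewrite -ba subrK.
by rewrite mulrDl mulrDr -scalerAl -scalerAr yxa.
Qed.

End Identities.

End Relations.

Record is_UqB2 (K : fieldType) (q : K) (U : algType K) (x y : U) : Prop := IsUqB2 {
  UqB2_serre1 : serre1 q x y = 0;
  UqB2_ind : forall P : U -> Prop, (forall c, P c%:A) -> P x -> P y ->
    (forall u v, P u -> P v -> P (u + v)) ->
    (forall u v, P u -> P v -> P (u * v)) -> forall u, P u;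
  UqB2_univ : forall (A : algType K) (u v : A),
    serre1 q u v = 0 -> serre2 q u v = 0 ->
    exists f : {lrmorphism U -> A}, f x = u /\ f y = v
}.

Lemma UqB2_is_UqB2 (K : fieldType) (q : K) : is_UqB2 q (e1 q) (e2 q).
Proof.
split; first exact: serre1_e.
- move=> P PC P1 P2 PD PM u; rewrite -(UqB2_projK u).
  have PX i : P (UqB2_proj q (free_gen K i)).
    have [->|->] // : i = ord0 \/ i = ord_max.
    by case: i => -[|[|//]] ?; [left|right]; apply: val_inj.
  move: (repr u) => g; rewrite [g]monalgE raddf_sum /=.
  apply: (big_ind P) => [|//|k _]; first by rewrite -(scale0r 1).
  move: (g@_k) => c; rewrite -[k]fmK; elim: (k : seq _) => [|i s IHs].
    have -> : << c *g FMonom [::] >> = c%:A :> free_alg2 K.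
      by rewrite -mul_malgC malgM_def fgmulUU mulr1 mul1m -fmoneE.
    by rewrite -UqB2_projZ; apply: PC.
  have -> : << c *g FMonom (i :: s) >> =
      free_gen K i * << c *g FMonom s >> :> free_alg2 K.
    by rewrite /free_gen malgM_def fgmulUU mul1r /mmul /= fmmulE fmuE.
  by rewrite -UqB2_projM; apply: PM.
move=> A u v s1 s2.
pose f : {lrmorphism UqB2 q -> A} := HB.pack (UqB2_lift u v)
  (GRing.isZmodMorphism.Build _ _ _ (UqB2_lift_zmod s1 s2))
  (GRing.isMonoidMorphism.Build _ _ _ (UqB2_lift_monoid s1 s2))
  (GRing.isScalable.Build _ _ _ _ _ (UqB2_lift_scalable s1 s2)).
by exists f; split; [apply: UqB2_lift_e1|apply: UqB2_lift_e2].
Qed.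

(** * Elements commuting up to a scalar *)

Section QCommutation.
Variables (K : fieldType) (A : algType K).
Implicit Types (c d : K) (x y : A).

Definition qcomm c x y := x * y = c *: (y * x).

Lemma qcomm_sym c x y : c != 0 -> qcomm c x y -> qcomm c^-1 y x.
Proof. by move=> c0 xy; rewrite /qcomm xy scalerA mulVf // scale1r. Qed.

Lemma qcomm1 x : qcomm 1 x 1.
Proof. by rewrite /qcomm mulr1 mul1r scale1r. Qed.

Lemma qcommM c d x y y' : qcomm c x y -> qcomm d x y' -> qcomm (c * d) x (y * y').
Proof.
move=> xy xy'; rewrite /qcomm mulrA xy -scalerAl -[y * x * y']mulrA xy'.
by rewrite -scalerAr scalerA mulrA.
Qed.

Lemma qcommX c x y k : qcomm c x y -> qcomm (c ^+ k) x (y ^+ k).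
Proof.
move=> xy; elim: k => [|k IHk]; first by rewrite !expr0; apply: qcomm1.
by rewrite !exprS; apply: qcommM.
Qed.

Lemma qcommD c x y y' : qcomm c x y -> qcomm c x y' -> qcomm c x (y + y').
Proof. by rewrite /qcomm mulrDr mulrDl scalerDr => -> ->. Qed.

Lemma qcommZ c x y d : qcomm c x y -> qcomm c x (d *: y).
Proof. by rewrite /qcomm -scalerAr -scalerAl => ->; rewrite !scalerA mulrC. Qed.

Lemma qcomm_horner x y (p : {poly K}) : qcomm 1 x y -> qcomm 1 x (horner_alg y p).
Proof.
move=> xy; elim/poly_ind: p => [|p c IHp].
  by rewrite raddf0 /qcomm mulr0 mul0r scaler0.
rewrite rmorphD rmorphM /= horner_algC horner_algX; apply: qcommD.
  by rewrite -[1]mulr1; apply: qcommM.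
by apply/qcommZ/qcomm1.
Qed.

(* Applying X |-> n X - lam0 X n repeatedly kills the components of the
   eigenvalues lam0 other than mu, and multiplies the remaining one by n. *)
Lemma qcomm_separation (T : eqType) (n : A) (s : seq T) (F : T -> A) (lam : T -> K) mu :
  (forall t, qcomm (lam t) n (F t)) -> \sum_(t <- s) F t = 0 ->
  exists N, (\sum_(t <- s | lam t == mu) F t) * n ^+ N = 0.
Proof.
have [m] := ubnP (size s); elim: m s F => // m IHm s F sm nF sF.
have [/hasP[t0 t0s t0mu]|] := boolP (has (fun t => lam t != mu) s); last first.
  rewrite -all_predC => /allP smu; exists 0%N; rewrite expr0 mulr1 -[RHS]sF.
  rewrite big_seq_cond [RHS]big_seq; apply: eq_bigl => t.
  by case ts: (t \in s) => //=; rewrite (negbNE (smu t ts)).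
have [|t||N sN] := IHm [seq t <- s | lam t != lam t0]
    (fun t => (lam t - lam t0) *: (F t * n)).
- rewrite -ltnS; apply: leq_trans sm; rewrite ltnS size_filter.
  rewrite -(count_predC (fun t => lam t == lam t0)) -[X in (X < _)%N]add0n ltn_add2r.
  by rewrite -has_count; apply/hasP; exists t0.
- apply: qcommZ; rewrite -[lam t]mulr1; apply: qcommM => //.
  by rewrite /qcomm scale1r.
- have e : \sum_(t <- s) (lam t - lam t0) *: (F t * n) = 0.
    under eq_bigr => t _ do rewrite scalerBl -nF.
    by rewrite sumrB -scaler_sumr -mulr_sumr -mulr_suml sF mulr0 mul0r scaler0 subrr.
  rewrite big_filter big_mkcond -[RHS]e; apply: eq_bigr => t _.
  by case: eqP => //= ->; rewrite subrr scale0r.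
exists N.+1; have mu0 : mu - lam t0 != 0 by rewrite subr_eq0 eq_sym.
apply/eqP; rewrite exprS mulrA -[_ == 0](inj_eq (scalerI mu0)) scaler0 scalerAl.
rewrite -[X in _ == X]sN big_filter_cond mulr_suml scaler_sumr.
apply/eqP; congr (_ * _); symmetry.
rewrite (eq_bigl (fun t => lam t == mu)) => [|t]; last first.
  by have [->|] := eqVneq (lam t) mu; rewrite ?andbF // eq_sym t0mu.
by apply: eq_bigr => t /eqP->.
Qed.

End QCommutation.

(** * Uniqueness of normal forms modulo z *)

Definition int_pow (A : nzRingType) (x y : A) (k : int) : A :=
  match k with Posz n => x ^+ n | Negz n => y ^+ n.+1 end.

Definition rregular (A : nzRingType) (n : A) := forall f, f * n = 0 -> f = 0.

Lemma rregularX (A : nzRingType) (n : A) : rregular n -> forall k, rregular (n ^+ k).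
Proof.
move=> nr k f; elim: k => [|k IHk]; first by rewrite expr0 mulr1.
by rewrite exprSr mulrA => /nr.
Qed.

Lemma qcomm_int_pow (K : fieldType) (A : algType K) (c : K) (n x y : A) (k : int) :
  qcomm c n x -> qcomm c^-1 n y -> qcomm (c ^ k) n (int_pow x y k).
Proof.
move=> nx ny; case: k => k /=; first exact: qcommX.
by rewrite NegzE -exprz_inv -[c^-1 ^ _]/(c^-1 ^+ k.+1); apply: qcommX.
Qed.

Lemma expfz_inj (K : fieldType) (r : K) : (forall n, (0 < n)%N -> r ^+ n != 1) ->
  r != 0 -> injective (exprz r).
Proof.
move=> r1 r0 m n /eqP; rewrite -subr_eq0; wlog: m n / (m <= n)%R.
  move=> W h; case: (lerP m n) => [mn|/ltW nm]; first exact: W.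
  by apply/esym/W => //; rewrite -opprB oppr_eq0.
move=> mn; have [k ->] : exists k : nat, n = m + k.
  by exists `|n - m|%N; rewrite gez0_abs ?subr_ge0 // [RHS]addrC subrK.
case: k => [|k]; first by rewrite addr0.
rewrite expfzDr // -{1}[r ^ m]mulr1 -mulrBr mulf_eq0 (negbTE (expfz_neq0 _ r0)).
by rewrite subr_eq0 eq_sym (negbTE (r1 _ _)).
Qed.

Section WeylAlgebra.
Variables (K : fieldType) (A : algType K) (r c1 c2 : K) (u v a b : A).
Hypothesis W : weyl_rel r c1 c2 u v a b.
Hypotheses (r0 : r != 0) (c10 : c1 != 0) (c20 : c2 != 0).
Hypothesis r1 : forall n, (0 < n)%N -> r ^+ n != 1.

Let ua : qcomm r^-1 u a. Proof. by case: W. Qed.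
Let ub : qcomm r u b. Proof. by case: W. Qed.
Let va : qcomm r v a. Proof. by case: W. Qed.
Let vb : qcomm r^-1 v b. Proof. by case: W. Qed.
Let au : qcomm r a u.
Proof. by have := qcomm_sym _ ua; rewrite invrK; apply; rewrite invr_eq0. Qed.
Let bu : qcomm r^-1 b u. Proof. exact: qcomm_sym. Qed.
Let ab : a * b = b * a. Proof. by case: W. Qed.

Lemma weyl_central (d : K) : let w := d *: (a * b) in
  [/\ qcomm 1 u w, qcomm 1 v w, qcomm 1 a w & qcomm 1 b w].
Proof.
have aa x : qcomm 1 x x by rewrite /qcomm scale1r.
have [ab1 ba1] : qcomm 1 a b /\ qcomm 1 b a by rewrite /qcomm !scale1r ab.
split; apply: qcommZ.
- by rewrite -(mulVf r0); apply: qcommM.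
- by rewrite -(mulfV r0); apply: qcommM.
- by rewrite -[1]mulr1; apply: qcommM.
- by rewrite -[1]mulr1; apply: qcommM.
Qed.

Lemma weyl_uXv k : u ^+ k.+1 * v =
  (c1 * r ^+ k.+1) *: (b * u ^+ k) - (c2 * r ^- k.+1) *: (a * u ^+ k).
Proof.
rewrite exprSr -mulrA (weyl_uv W) mulrBr -!scalerAr.
have ubk : b * u ^+ k = r ^- k *: (u ^+ k * b).
  by rewrite -exprVn; apply: qcommX.
have uak : a * u ^+ k = r ^+ k *: (u ^+ k * a) by apply: qcommX.
rewrite ubk uak !scalerA; congr (_ *: _ - _ *: _).
  by rewrite exprS mulrA mulfK ?expf_neq0.
by rewrite exprS invfM mulrA mulfVK ?expf_neq0.
Qed.

Lemma weyl_descent g mu : mu != 0 -> qcomm mu v g -> rregular a \/ rregular b ->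
  forall k, g * u ^+ k = 0 -> g = 0.
Proof.
move=> mu0 vg reg; elim=> [|k IHk]; first by rewrite expr0 mulr1.
move=> guk; apply: IHk.
set B := g * (b * u ^+ k); set C := g * (a * u ^+ k).
have e1 : (c1 * r ^+ k.+1) *: B = (c2 * r ^- k.+1) *: C.
  apply/eqP; rewrite -subr_eq0 !(scalerAr _ g) -mulrBr -weyl_uXv.
  by rewrite mulrA guk mul0r.
have e2 : c1 *: B = c2 *: C.
  apply/eqP; rewrite -subr_eq0 !(scalerAr _ g) -mulrBr.
  rewrite (scalerAl _ b) (scalerAl _ a) -mulrBl -(weyl_vu W) -mulrA -exprS mulrA.
  by rewrite -(inj_eq (scalerI mu0)) scaler0 scalerAl -[_ *: _]vg -mulrA guk mulr0.
have det : r ^+ k.+1 - r ^- k.+1 != 0.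
  rewrite subr_eq0; apply: contra_neq (r1 (isT : 0 < k.+1 + k.+1)%N) => h.
  by rewrite exprD {2}h mulfV ?expf_neq0.
have B0 : B = 0.
  have : (c1 * (r ^+ k.+1 - r ^- k.+1)) *: B = 0.
    rewrite mulrBr scalerBl e1 [c1 * _]mulrC -[X in _ - X]scalerA e2 scalerA.
    by rewrite [c2 * _]mulrC subrr.
  by move/eqP; rewrite scaler_eq0 mulf_eq0 (negbTE c10) (negbTE det) => /eqP.
have C0 : C = 0.
  by move/eqP: e2; rewrite B0 scaler0 eq_sym scaler_eq0 (negbTE c20) => /eqP.
case: reg => rg; apply: rg; apply/eqP.
  rewrite -(inj_eq (scalerI (expf_neq0 k r0))) scaler0 -mulrA scalerAr.
  by rewrite -[_ *: _](qcommX k au) -/C C0.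
rewrite -(inj_eq (scalerI (expf_neq0 k (invr_neq0 r0)))) scaler0 -mulrA scalerAr.
by rewrite -[_ *: _](qcommX k bu) -/B B0.
Qed.

Lemma weyl_separation (S : seq int) (G : int -> A) k : uniq S ->
  (forall m, qcomm (r^-1 ^ m) u (G m)) -> (forall m, qcomm (r ^ m) v (G m)) ->
  rregular a \/ rregular b -> \sum_(m <- S) G m * u ^+ k = 0 ->
  {in S, forall m, G m = 0}.
Proof.
move=> Su uG vG reg SG m mS.
have [|N] := qcomm_separation (n := u) (lam := exprz r^-1) (r^-1 ^ m) _ SG.
  move=> i; rewrite -[_ ^ i]mulr1; apply: qcommM => //.
  by rewrite -[1](expr1n _ k); apply: qcommX; rewrite /qcomm scale1r.
have rinj := expfz_inj (r := r^-1) _ (invr_neq0 r0).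
rewrite (eq_bigl (pred1 m)) => [|i]; last first.
  rewrite /= (inj_eq (rinj _)) // => n n0; rewrite exprVn.
  by rewrite -[1]invr1 (inj_eq invr_inj) r1.
rewrite -big_filter filter_pred1_uniq // big_seq1 -mulrA -exprD.
exact: weyl_descent (expfz_neq0 m r0) (vG m) reg _.
Qed.

End WeylAlgebra.

Section WeylNormalForm.
Variables (K : fieldType) (A : algType K) (r c1 c2 : K) (u v a b : A).
Hypothesis W : weyl_rel r c1 c2 u v a b.
Hypotheses (r0 : r != 0) (c10 : c1 != 0) (c20 : c2 != 0).
Hypothesis r1 : forall n, (0 < n)%N -> r ^+ n != 1.
Variable d : K.
Let w := d *: (a * b).

Lemma weyl_normal_form_unique (S : seq (int * int)) (p : int * int -> {poly K}) :
  uniq S -> rregular a \/ rregular b ->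
  \sum_(s <- S) horner_alg w (p s) * int_pow a b s.1 * int_pow u v s.2 = 0 ->
  {in S, forall s, horner_alg w (p s) * int_pow a b s.1 = 0}.
Proof.
move=> Su reg sS [m k] mkS.
have Ws := weyl_rel_sym r0 W; have rV0 := invr_neq0 r0.
have rV1 n : (0 < n)%N -> r^-1 ^+ n != 1.
  by move=> n0; rewrite exprVn -[1]invr1 (inj_eq invr_inj) r1.
have [uw vw aw bw] := weyl_central W r0 d.
have hM c n s : qcomm 1 n w -> qcomm (c ^ s.1) n (int_pow a b s.1) ->
    qcomm (c ^ s.1) n (horner_alg w (p s) * int_pow a b s.1).
  by move=> nw nM; rewrite -[c ^ _]mul1r; apply: qcommM => //; apply: qcomm_horner.
have uM s : qcomm (r^-1 ^ s.1) u (horner_alg w (p s) * int_pow a b s.1).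
  by apply: hM => //; apply: qcomm_int_pow; [case: W|rewrite invrK; case: W].
have vM s : qcomm (r ^ s.1) v (horner_alg w (p s) * int_pow a b s.1).
  by apply: hM => //; apply: qcomm_int_pow; case: W.
have {sS} : \sum_(s <- S | s.2 == k)
    horner_alg w (p s) * int_pow a b s.1 * int_pow u v s.2 = 0.
  have aa x : qcomm 1 x x by rewrite /qcomm scale1r.
  have [ab1 ba1] : qcomm 1 a b /\ qcomm 1 b a.
    by rewrite /qcomm !scale1r; case: W => *; split.
  have a1 s : qcomm 1 a (horner_alg w (p s) * int_pow a b s.1).
    rewrite -(exp1rz K s.1); apply: hM => //.
    by apply: qcomm_int_pow; rewrite ?invr1.
  have b1 s : qcomm 1 b (horner_alg w (p s) * int_pow a b s.1).
    rewrite -(exp1rz K s.1); apply: hM => //.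
    by apply: qcomm_int_pow; rewrite ?invr1.
  case: reg => reg.
    have [|N] := qcomm_separation (n := a) (lam := fun s => r ^ s.2) (r ^ k) _ sS.
      move=> s; rewrite -[r ^ _]mul1r; apply: qcommM => //.
      apply: qcomm_int_pow; last by apply: qcomm_sym; case: W.
      by rewrite -[r]invrK; apply: qcomm_sym => //; case: W.
    move/(rregularX reg) => e; rewrite -[RHS]e; apply: eq_bigl => s.
    by rewrite (inj_eq (expfz_inj r1 r0)).
  have [|N] := qcomm_separation (n := b) (lam := fun s => r^-1 ^ s.2) (r^-1 ^ k) _ sS.
    move=> s; rewrite -[r^-1 ^ _]mul1r; apply: qcommM => //.
    apply: qcomm_int_pow; first by apply: qcomm_sym; case: W.
    by apply: qcomm_sym => //; case: W.
  move/(rregularX reg) => e; rewrite -[RHS]e; apply: eq_bigl => s.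
  by rewrite (inj_eq (expfz_inj rV1 rV0)).
pose S1 := [seq s.1 | s <- S & s.2 == k].
have S1u : uniq S1.
  rewrite map_inj_in_uniq ?filter_uniq // => -[m1 k1] [m2 k2].
  by rewrite !mem_filter /= => /andP[/eqP-> _] /andP[/eqP-> _] ->.
have mS1 : m \in S1 by apply/mapP; exists (m, k); rewrite ?mem_filter ?eqxx.
have -> : \sum_(s <- S | s.2 == k)
    horner_alg w (p s) * int_pow a b s.1 * int_pow u v s.2 =
    \sum_(m <- S1) horner_alg w (p (m, k)) * int_pow a b m * int_pow u v k.
  by rewrite big_map big_filter; apply: eq_bigr => -[m1 k1] /= /eqP->.
case: k => k in S1 S1u mS1 mkS *; rewrite [int_pow u v _]/= => sS1.
  apply: (weyl_separation W r0 c10 c20 r1 S1u _ _ reg sS1) mS1 => i.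
    exact: (uM (i, Posz k)).
  exact: (vM (i, Posz k)).
have c1r : c1 * r != 0 by rewrite mulf_neq0.
have c2r : c2 / r != 0 by rewrite mulf_neq0.
apply: (weyl_separation Ws rV0 c1r c2r rV1 S1u _ _ reg sS1) mS1 => i.
  by rewrite invrK; exact: (vM (i, Negz k)).
exact: (uM (i, Negz k)).
Qed.

End WeylNormalForm.

(** * Existence of normal forms modulo z *)

Lemma partition_big_seq (V : nmodType) (I J : eqType) (h : I -> J) (s : seq I) (F : I -> V) :
  \sum_(i <- s) F i = \sum_(j <- undup (map h s)) \sum_(i <- s | h i == j) F i.
Proof.
rewrite (exchange_big_dep xpredT) //= big_seq [RHS]big_seq; apply: eq_bigr => i si.
rewrite (eq_bigl (pred1 (h i))) => [|j]; last by rewrite eq_sym.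
by rewrite -big_filter filter_pred1_uniq ?undup_uniq ?mem_undup ?map_f // big_seq1.
Qed.

Section WeylSpan.
Variables (K : fieldType) (A : algType K).

Definition wmono (u v a b : A) (t : K * (nat * nat) * int) : A :=
  t.1.1 *: (a ^+ t.1.2.1 * b ^+ t.1.2.2 * int_pow u v t.2).

Definition wspan (u v a b f : A) := exists s, f = \sum_(t <- s) wmono u v a b t.

Section Closure.
Variables (r c1 c2 : K) (u v a b : A).
Hypothesis W : weyl_rel r c1 c2 u v a b.
Hypotheses (r0 : r != 0).
Local Notation Sp := (wspan u v a b).

Lemma wspanD f g : Sp f -> Sp g -> Sp (f + g).
Proof. by case=> s -> [s' ->]; exists (s ++ s'); rewrite big_cat. Qed.

Lemma wspanZ c f : Sp f -> Sp (c *: f).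
Proof.
case=> s ->; exists [seq (c * t.1.1, t.1.2, t.2) | t <- s].
by rewrite big_map scaler_sumr; apply: eq_bigr => t _; rewrite /wmono /= scalerA.
Qed.

Lemma wspan_mono i j k : Sp (a ^+ i * b ^+ j * int_pow u v k).
Proof. by exists [:: (1, (i, j), k)]; rewrite big_seq1 /wmono scale1r. Qed.

Lemma wspan_u i j k : Sp (a ^+ i * b ^+ j * u ^+ k).
Proof. exact: (wspan_mono i j k). Qed.

Lemma wspan_v i j k : Sp (a ^+ i * b ^+ j * v ^+ k).
Proof.
by case: k => [|k]; [exact: (wspan_mono i j 0)|exact: (wspan_mono i j (Negz k))].
Qed.

Let ab k : b ^+ k * a = a * b ^+ k.
Proof. by apply/commr_sym/commrX; rewrite /GRing.comm; case: W. Qed.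

Lemma wspan_combine i j n c d : (forall i j, Sp (a ^+ i * b ^+ j * n)) ->
  Sp (a ^+ i * b ^+ j * (c *: (b * n) - d *: (a * n))).
Proof.
move=> Spn; rewrite mulrBr -!scalerAr -scaleNr.
have -> : a ^+ i * b ^+ j * (b * n) = a ^+ i * b ^+ j.+1 * n.
  by rewrite exprSr !mulrA.
have -> : a ^+ i * b ^+ j * (a * n) = a ^+ i.+1 * b ^+ j * n.
  by rewrite exprSr -[a ^+ i * a * _]mulrA -ab !mulrA.
by apply: wspanD; apply: wspanZ.
Qed.

Lemma wspanMu f : Sp f -> Sp (f * u).
Proof.
case=> s ->; rewrite mulr_suml; apply: (big_ind Sp) => [||t _].
- by exists [::]; rewrite big_nil.
- exact: wspanD.
rewrite -scalerAl; apply: wspanZ; rewrite -[_ * u]mulrA.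
case: (t.2) => k; rewrite [int_pow _ _ _]/=; first by rewrite -exprSr; apply: wspan_u.
rewrite (weyl_uXv (weyl_rel_sym r0 W)) ?invr_neq0 //.
by apply: wspan_combine => *; apply: wspan_v.
Qed.

Lemma wspanMv f : Sp f -> Sp (f * v).
Proof.
case=> s ->; rewrite mulr_suml; apply: (big_ind Sp) => [||t _].
- by exists [::]; rewrite big_nil.
- exact: wspanD.
rewrite -scalerAl; apply: wspanZ; rewrite -[_ * v]mulrA.
case: (t.2) => [[|k]|k]; rewrite [int_pow _ _ _]/=.
- by rewrite mul1r; apply: (wspan_v _ _ 1).
- rewrite (weyl_uXv W) //.
  by apply: wspan_combine => *; apply: wspan_u.
by rewrite -exprSr; apply: wspan_v.
Qed.

Lemma wspan_normal_form d f : d != 0 -> Sp f ->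
  exists (S : seq (int * int)) (p : int * int -> {poly K}), uniq S /\
    f = \sum_(s <- S) horner_alg (d *: (a * b)) (p s) * int_pow a b s.1 * int_pow u v s.2.
Proof.
move=> d0 [s ->].
pose h (t : K * (nat * nat) * int) : int * int := (t.1.2.1%:Z - t.1.2.2%:Z, t.2).
pose e (t : K * (nat * nat) * int) := minn t.1.2.1 t.1.2.2.
exists (undup (map h s)), (fun c => \sum_(t <- s | h t == c) (t.1.1 / d ^+ e t) *: 'X^(e t)).
split; first exact: undup_uniq.
rewrite (partition_big_seq h); apply: eq_bigr => c _.
rewrite raddf_sum /= !mulr_suml; apply: eq_bigr => t /eqP<- /=.
rewrite linearZ /= rmorphXn /= horner_algX mulr_algl exprZn scalerA divfK ?expf_neq0 //.
rewrite -!scalerAl /wmono; congr (_ *: (_ * _)).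
have cab : GRing.comm a b by case: W.
rewrite exprMn_comm // /e /h; case: (t.1.2) => i j /=.
case: (leqP j i) => [|/ltnW] ij.
  rewrite subzn //= -{1}(subnK ij) addnC exprD -!mulrA; congr (_ * _).
  exact: commrX (commr_sym (commrX _ (commr_sym cab))).
rewrite -opprB subzn // -{1}(subnKC ij).
rewrite -[RHS]mulrA; congr (_ * _); case: (j - i)%N => [|k].
  by rewrite addn0 mulr1.
by rewrite exprD.
Qed.
End Closure.
End WeylSpan.

(** * Two-sided ideals *)

Section IdealTheory.
Variables (K : fieldType) (A : algType K).
Implicit Types (I J P : set A) (u f g n : A).

Section Ideal.
Variable I : set A.
Hypothesis II : two_sided_ideal I.

Lemma two_sided_ideal0 : I 0. Proof. by case: II. Qed.
Lemma two_sided_idealD f g : I f -> I g -> I (f + g). Proof. by case: II => _ + _ _; apply. Qed.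
Lemma two_sided_idealMl u f : I f -> I (u * f). Proof. by case: II => _ _ + _; apply. Qed.
Lemma two_sided_idealMr u f : I f -> I (f * u). Proof. by case: II => _ _ _; apply. Qed.
Lemma two_sided_idealZ c f : I f -> I (c *: f).
Proof. by rewrite -mulr_algl; apply: two_sided_idealMl. Qed.


Lemma ideal_sum (T : eqType) (s : seq T) (F : T -> A) :
  {in s, forall t, I (F t)} -> I (\sum_(t <- s) F t).
Proof.
move=> sF; rewrite big_seq; apply: (big_ind I) => //; first exact: two_sided_ideal0.
exact: two_sided_idealD.
Qed.

Lemma ideal_subr f g : I (f - g) -> I g -> I f.
Proof. by move=> fg If; rewrite -(subrK g f); apply: two_sided_idealD. Qed.

Lemma ideal_subl f g : I (f - g) -> I f -> I g.
Proof. by move=> fg If; rewrite -[g](subKr f); apply: two_sided_idealB. Qed.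

Lemma ideal_scalar c : ~ I 1 -> I c%:A -> c = 0.
Proof.
move=> I1 Ic; have [//|c0] := eqVneq c 0; case: I1.
by rewrite -[1](scalerK c0); apply: two_sided_idealZ.
Qed.

Lemma ideal_proper : ~ I 1 -> I <> setT.
Proof. by move=> I1 IT; apply: I1; rewrite IT. Qed.

Lemma ideal_horner c (b : K) (p : {poly K}) :
  I (c - b%:A) -> I (horner_alg c p - p.[b]%:A).
Proof.
move=> Icb; have /factor_theorem[p' pE] : root (p - p.[b]%:P) b.
  by rewrite /root !hornerE subrr.
have -> : horner_alg c p - p.[b]%:A = horner_alg c (p - p.[b]%:P).
  by rewrite raddfB /= horner_algC.
rewrite pE rmorphM raddfB /= horner_algC horner_algX; exact: two_sided_idealMl.
Qed.

End Ideal.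

Definition ideal_add I J := [set f | exists2 g, I g & J (f - g)].

Lemma ideal_add_ideal I J : two_sided_ideal I -> two_sided_ideal J ->
  two_sided_ideal (ideal_add I J).
Proof.
move=> II JI; split=> [|f f' [g Ig fg] [g' Ig' fg']|u f [g Ig fg]|u f [g Ig fg]].
- by exists 0; rewrite ?subrr; apply: two_sided_ideal0.
- by exists (g + g'); [apply: two_sided_idealD|rewrite opprD addrACA; apply: two_sided_idealD].
- by exists (u * g); [apply: two_sided_idealMl|rewrite -mulrBr; apply: two_sided_idealMl].
- by exists (g * u); [apply: two_sided_idealMr|rewrite -mulrBl; apply: two_sided_idealMr].
Qed.

Lemma ideal_add_subl I J : two_sided_ideal J -> I `<=` ideal_add I J.
Proof. by move=> JI f If; exists f => //; rewrite subrr; apply: two_sided_ideal0. Qed.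

Lemma ideal_add_subr I J : two_sided_ideal I -> J `<=` ideal_add I J.
Proof. by move=> II f Jf; exists 0; [apply: two_sided_ideal0|rewrite subr0]. Qed.

Lemma prime_ideal_ideal P : prime_ideal P -> two_sided_ideal P.
Proof. by case. Qed.

Lemma prime_ideal1 P : prime_ideal P -> ~ P 1.
Proof.
case=> PI PT _ P1; apply: PT; apply/seteqP; split=> // u _.
by rewrite -[u]mulr1; apply: two_sided_idealMl.
Qed.

Lemma prime_ideal_mul P f g : prime_ideal P ->
  (forall u, P (f * u * g)) -> P f \/ P g.
Proof.
move=> [PI _ Pprime] fg.
pose I1 := [set x | forall u, P (x * u * g)].
pose I2 := [set y | forall x u, I1 x -> P (x * u * y)].
have II1 : two_sided_ideal I1.
  split=> [u|x y Ix Iy u|a x Ix u|a x Ix u].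
  - by rewrite !mul0r; apply: two_sided_ideal0.
  - by rewrite !mulrDl; apply: two_sided_idealD.
  - by rewrite -!mulrA; apply: two_sided_idealMl; rewrite ?mulrA.
  - by rewrite -(mulrA x).
have II2 : two_sided_ideal I2.
  split=> [x u Ix|y y' Iy Iy' x u Ix|a y Iy x u Ix|a y Iy x u Ix].
  - by rewrite !mulr0; apply: two_sided_ideal0.
  - by rewrite mulrDr; apply: two_sided_idealD => //; [apply: Iy|apply: Iy'].
  - by rewrite mulrA -(mulrA x); apply: Iy.
  - by rewrite mulrA; apply: two_sided_idealMr => //; apply: Iy.
have [|I1P|I2P] := Pprime I1 I2 II1 II2.
- by move=> x y Ix Iy; rewrite -[x]mulr1; apply: Iy.
- by left; apply: I1P.
by right; apply: I2P => x u; apply.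
Qed.

Lemma maximal_ideal_prime J : two_sided_ideal J -> ~ J 1 ->
  (forall I, two_sided_ideal I -> J `<=` I -> ~ I 1 -> I `<=` J) -> prime_ideal J.
Proof.
move=> JI J1 Jmax; split=> //; first exact: ideal_proper.
have key I : two_sided_ideal I -> ~ I `<=` J -> exists2 f, I f & J (1 - f).
  move=> II IJ; have SI := ideal_add_ideal II JI.
  have [IS JS] := (@ideal_add_subl I J JI, @ideal_add_subr I J II).
  have [[f If ?]|S1] := pselect (ideal_add I J 1); first by exists f.
  by case: IJ; apply: subset_trans IS _; apply: Jmax.
move=> I1 I2 II1 II2 I12; have [?|/(key _ II1)[f If Jf]] := pselect (I1 `<=` J); first by left.
have [?|/(key _ II2)[g Ig Jg]] := pselect (I2 `<=` J); first by right.
case: J1; apply: (ideal_subr JI (g := f * g)); last exact: I12.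
have -> : 1 - f * g = (1 - f) * g + (1 - g) by rewrite mulrBl mul1r [RHS]addrC addrA subrK.
by apply: two_sided_idealD => //; apply: two_sided_idealMr.
Qed.

Definition normal_mod J n := forall u, exists u', J (u * n - n * u').

Lemma normal_modX J n N : two_sided_ideal J -> normal_mod J n -> normal_mod J (n ^+ N).
Proof.
move=> JI nn; elim: N => [|N IHN] u.
  by exists u; rewrite expr0 mulr1 mul1r subrr; apply: two_sided_ideal0.
have [u' uu'] := nn u; have [u'' uu''] := IHN u'; exists u''.
have -> : u * n ^+ N.+1 - n ^+ N.+1 * u'' =
    (u * n - n * u') * n ^+ N + n * (u' * n ^+ N - n ^+ N * u'').
  by rewrite mulrBl mulrBr exprS !mulrA addrA subrK.
by apply: two_sided_idealD => //; [apply: two_sided_idealMr|apply: two_sided_idealMl].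
Qed.

Section Saturation.
Variables (J : set A) (n : A).
Hypotheses (JI : two_sided_ideal J) (nn : normal_mod J n).

Lemma prime_rregular P : prime_ideal P -> J `<=` P -> ~ P n ->
  forall f, P (f * n) -> P f.
Proof.
move=> Pp JP Pn f Pfn; have PI := prime_ideal_ideal Pp.
have [u|//|//] := prime_ideal_mul (f := f) (g := n) Pp.
have [u' uu'] := nn u; rewrite -mulrA.
apply: (ideal_subr PI (g := f * n * u')); last exact: two_sided_idealMr.
by rewrite -mulrA -mulrBr; apply: two_sided_idealMl => //; apply: JP.
Qed.

Definition saturation I := [set f | exists N, I (f * n ^+ N)].

Lemma saturation_ideal I : two_sided_ideal I -> J `<=` I ->
  two_sided_ideal (saturation I).
Proof.
move=> II JI'; have up f N M : I (f * n ^+ N) -> I (f * n ^+ (N + M)).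
  by move=> If; rewrite exprD mulrA; apply: two_sided_idealMr.
split=> [|f g [N fN] [M gM]|u f [N fN]|u f [N fN]].
- by exists 0%N; rewrite mul0r; apply: two_sided_ideal0.
- exists (N + M)%N; rewrite mulrDl; apply: two_sided_idealD => //; first exact: up.
  by rewrite addnC; apply: up.
- by exists N; rewrite -mulrA; apply: two_sided_idealMl.
exists N; have [u' uu'] := normal_modX N JI nn u; rewrite -mulrA.
apply: (ideal_subr II (g := f * n ^+ N * u')); last exact: two_sided_idealMr.
by rewrite -mulrA -mulrBr; apply: two_sided_idealMl => //; apply: JI'.
Qed.

(* If I1 I2 lies in J while I1 and I2 do not, then the saturations of I1 + J and
   I2 + J are improper, so both contain powers of n, and so does J. *)
Lemma saturated_prime : (forall N, ~ J (n ^+ N)) ->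
  (forall I, two_sided_ideal I -> J `<=` I -> ~ I 1 ->
    (forall f, I (f * n) -> I f) -> I `<=` J) ->
  prime_ideal J.
Proof.
move=> nJ core; split=> //.
  by apply: ideal_proper => // J1; apply: (nJ 0%N); rewrite expr0.
have key I : two_sided_ideal I -> ~ I `<=` J -> exists N, exists2 g, I g & J (n ^+ N - g).
  move=> II IJ; have SI := ideal_add_ideal II JI.
  have [IS JS] := (@ideal_add_subl I J JI, @ideal_add_subr I J II).
  set S := ideal_add I J in SI IS JS *.
  have sub f : S f -> saturation S f by exists 0%N; rewrite expr0 mulr1.
  have [[N]|S1] := pselect (saturation S 1).
    by rewrite mul1r => -[g Ig Jg]; exists N, g.
  case: IJ => f If; apply: (core (saturation S)) => //.
  - exact: saturation_ideal.
  - by move=> g Jg; apply/sub/JS.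
  - by move=> g [N SN]; exists N.+1; rewrite exprS mulrA.
  - exact/sub/IS.
move=> I1 I2 II1 II2 I12; have [?|/(key _ II1)[N [f If Jf]]] := pselect (I1 `<=` J); first by left.
have [?|/(key _ II2)[M [g Ig Jg]]] := pselect (I2 `<=` J); first by right.
case: (nJ (N + M)%N); apply: (ideal_subr JI (g := f * g)); last exact: I12.
have -> : n ^+ (N + M) - f * g = (n ^+ N - f) * n ^+ M + f * (n ^+ M - g).
  by rewrite mulrBl mulrBr exprD addrA subrK.
by apply: two_sided_idealD => //; [apply: two_sided_idealMr|apply: two_sided_idealMl].
Qed.

End Saturation.
End IdealTheory.

(** * Strata *)

Lemma poly_nonroot (K : numClosedFieldType) (p : {poly K}) :
  p != 0 -> exists2 g : K, g != 0 & p.[g] != 0.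
Proof.
move=> p0; pose rs := [seq n.+1%:R : K | n <- iota 0 (size p)].
have rsu : uniq rs.
  rewrite map_inj_uniq ?iota_uniq // => m n /eqP.
  by rewrite eqr_nat => /eqP[].
have [prs|/allPn[g /mapP[n _ ->] pg]] := boolP (all (root p) rs).
  by have := max_poly_roots p0 prs rsu; rewrite size_map size_iota ltnn.
by exists n.+1%:R; rewrite // pnatr_eq0.
Qed.

Lemma prime_central_root (K : closedFieldType) (U : algType K) (P : set U) (c : U)
    (p : {poly K}) :
  prime_ideal P -> (forall u, P (c * u - u * c)) -> p != 0 -> P (horner_alg c p) ->
  exists g, P (c - g%:A).
Proof.
move=> Pp cc p0; have PI := prime_ideal_ideal Pp.
have [rs ->] := closed_field_poly_normal p; rewrite linearZ /= mulr_algl => Ph.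
have {Ph} : P (horner_alg c (\prod_(g <- rs) ('X - g%:P))).
  have l0 : lead_coef p != 0 by rewrite lead_coef_eq0.
  by rewrite -[X in P X](scalerK l0); apply: two_sided_idealZ.
elim: rs => [|g rs IHrs]; first by rewrite big_nil rmorph1 => /prime_ideal1.
rewrite big_cons rmorphM raddfB /= horner_algC horner_algX.
set h := horner_alg c _ in IHrs *; move=> Ph.
have [u|Pg|/IHrs//] := prime_ideal_mul (f := c - g%:A) (g := h) Pp; last by exists g.
apply: (ideal_subr PI (g := u * ((c - g%:A) * h))); last exact: two_sided_idealMl.
have -> : (c - g%:A) * u * h - u * ((c - g%:A) * h) = (c * u - u * c) * h.
  rewrite [u * (_ * h)]mulrA -mulrBl; congr (_ * h).
  by rewrite mulrBl mulrBr mulr_algl mulr_algr opprB addrA subrK.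
exact: two_sided_idealMr.
Qed.

Section Strata.
Variables (K : numClosedFieldType) (U : algType K) (act : K * K -> {lrmorphism U -> U}).
Hypothesis act1 : forall u, act (1, 1) u = u.
Hypothesis actM : forall h k u, act h (act k u) = act (h.1 * k.1, h.2 * k.2) u.
Implicit Types (I J P S : set U) (u n : U).

Definition strat J : set (set U) :=
  [set P | Spec P /\ \bigcap_(h in @torus K) (act h @` P) = J].

Definition weight_vector n := forall h, torus h -> exists c : K, act h n = c *: n.

Lemma act_preimage_ideal I h : two_sided_ideal I -> two_sided_ideal [set u | I (act h u)].
Proof.
move=> II; split=> [|u v /= Iu Iv|u v /= Iv|u v /= Iv].
- by rewrite /= raddf0; apply: two_sided_ideal0.
- by rewrite raddfD; apply: two_sided_idealD.
- by rewrite rmorphM; apply: two_sided_idealMl.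
- by rewrite rmorphM; apply: two_sided_idealMr.
Qed.

Lemma weight_ideal_stable S h : (forall n, S n -> weight_vector n) -> torus h ->
  forall u, ideal_gen S u -> ideal_gen S (act h u).
Proof.
move=> Sw ht; have SI := ideal_gen_ideal S.
apply: (ideal_gen_min (act_preimage_ideal h SI)) => n Sn /=.
by have [c ->] := Sw n Sn h ht; apply: (two_sided_idealZ SI); apply: ideal_gen_sub.
Qed.

Lemma torusV (h : K * K) : torus h -> torus (h.1^-1, h.2^-1).
Proof. by case=> h1 h2; split; rewrite /= invr_neq0. Qed.

Lemma actKV h u : torus h -> act h (act (h.1^-1, h.2^-1) u) = u.
Proof. by case=> h1 h2; rewrite actM /= !mulfV. Qed.

Lemma torus1 : torus ((1, 1) : K * K). Proof. by split; rewrite oner_eq0. Qed.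

Lemma bigcap_act_sub P : \bigcap_(h in @torus K) (act h @` P) `<=` P.
Proof. by move=> u /(_ _ torus1)[v Pv <-]; rewrite act1. Qed.

Lemma weight_ideal_sub_bigcap S P : (forall n, S n -> weight_vector n) ->
  ideal_gen S `<=` P -> ideal_gen S `<=` \bigcap_(h in @torus K) (act h @` P).
Proof.
move=> Sw SP u Su h ht; exists (act (h.1^-1, h.2^-1) u); last exact: actKV.
apply: (SP _ (weight_ideal_stable Sw (torusV ht) Su)).
Qed.

Lemma weight_ideal_bigcap S : (forall n, S n -> weight_vector n) ->
  \bigcap_(h in @torus K) (act h @` ideal_gen S) = ideal_gen S.
Proof.
move=> Sw; apply/seteqP; split; first exact: bigcap_act_sub.
exact: weight_ideal_sub_bigcap.
Qed.

Lemma strat_weight S P J n : two_sided_ideal P -> (forall n, S n -> weight_vector n) ->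
  \bigcap_(h in @torus K) (act h @` P) = J -> S `<=` P -> S n -> J n.
Proof.
move=> PI Sw <- SP Sn; apply: weight_ideal_sub_bigcap (ideal_gen_sub Sn) => //.
exact: ideal_gen_min.
Qed.

Lemma strat_sub J P : strat J P -> J `<=` P.
Proof. by case=> _ <-; apply: bigcap_act_sub. Qed.

Section SaturatedStratum.
Variables (d n : U).
Let J := ideal_gen [set d].
Hypotheses (dw : weight_vector d) (nw : weight_vector n).
Hypothesis nn : normal_mod J n.
Hypothesis nJ : forall N, ~ J (n ^+ N).
Hypothesis core : forall I, two_sided_ideal I -> J `<=` I -> ~ I 1 ->
    (forall f, I (f * n) -> I f) -> I `<=` J.

Lemma saturated_stratum : strat J = [set J].
Proof.
have JI : two_sided_ideal J := ideal_gen_ideal _.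
have dJ : forall m, [set d] m -> weight_vector m by move=> m ->.
apply/seteqP; split=> [P PJ|P ->]; last first.
  by split; [apply: saturated_prime core|apply: weight_ideal_bigcap].
have [Pp PE] := PJ; have PI := prime_ideal_ideal Pp; have JP := strat_sub PJ.
have Pn : ~ P n.
  move=> Pn; case: (@nJ 1%N); rewrite expr1.
  by apply: (strat_weight (S := [set n]) PI _ PE) => // m ->.
apply/seteqP; split=> //.
exact: core PI JP (prime_ideal1 Pp) (prime_rregular nn Pp JP Pn).
Qed.

End SaturatedStratum.

Section CentralStratum.
Variables (n c : U) (chi : K * K -> K) (adm : set U -> Prop).
Let J := ideal_gen [set n].
Let Jg g := ideal_gen [set n; c - g%:A].
Hypothesis nw : weight_vector n.
Hypothesis cw : forall h, torus h -> act h c = chi h *: c.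
Hypothesis chi_surj : forall g, g != 0 -> exists2 h, torus h & chi h = g.
Hypothesis cc : forall u, J (c * u - u * c).
Hypothesis J1 : forall g, g != 0 -> ~ Jg g 1.
Hypothesis adm_above : forall g I, g != 0 -> two_sided_ideal I -> Jg g `<=` I -> ~ I 1 -> adm I.
Hypothesis adm_stratum : forall P, strat J P -> adm P.
Hypothesis expansion : forall u, exists s : seq ({poly K} * U),
  J (u - \sum_(t <- s) horner_alg c t.1 * t.2) /\
  forall I, two_sided_ideal I -> J `<=` I -> adm I -> I u ->
    {in s, forall t, I (horner_alg c t.1)}.

Let JI : two_sided_ideal J. Proof. exact: ideal_gen_ideal. Qed.
Let JgI g : two_sided_ideal (Jg g). Proof. exact: ideal_gen_ideal. Qed.
Let JJg g : J `<=` Jg g.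
Proof. by apply: ideal_gen_min => // _ ->; apply: ideal_gen_sub; left. Qed.
Let Jgc g : Jg g (c - g%:A). Proof. by apply: ideal_gen_sub; right. Qed.

Lemma above_Jg g I p : g != 0 -> two_sided_ideal I -> Jg g `<=` I -> ~ I 1 ->
  I (horner_alg c p) -> p.[g] = 0.
Proof.
move=> g0 II JgIs I1 Ip; apply: (ideal_scalar II I1).
by apply: (ideal_subl II _ Ip); apply: ideal_horner => //; apply: JgIs.
Qed.

Lemma Jg_maximal g I : g != 0 -> two_sided_ideal I -> Jg g `<=` I -> ~ I 1 -> I `<=` Jg g.
Proof.
move=> g0 II JgIs I1 u Iu; have [s [us sI]] := expansion u.
apply: (ideal_subr (JgI g) (JJg us)); apply: (ideal_sum (JgI g)) => t ts.
apply: (two_sided_idealMr (JgI g)); have pt0 : t.1.[g] = 0.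
  apply: (above_Jg g0 II JgIs I1); apply: (sI I) ts => //.
    exact: subset_trans (@JJg g) JgIs.
  exact: (adm_above g0 II JgIs I1).
by have := ideal_horner (JgI g) t.1 (@Jgc g); rewrite pt0 scale0r subr0.
Qed.

Lemma Jg_prime g : g != 0 -> prime_ideal (Jg g).
Proof.
by move=> g0; apply: maximal_ideal_prime => //; [exact: J1|move=> I; exact: Jg_maximal].
Qed.

Lemma expansion_Jg u (s : seq ({poly K} * U)) g t : g != 0 ->
  (forall I, two_sided_ideal I -> J `<=` I -> adm I -> I u ->
    {in s, forall t, I (horner_alg c t.1)}) ->
  t \in s -> Jg g u -> t.1.[g] = 0.
Proof.
move=> g0 sI ts gu; have gg : Jg g `<=` Jg g by [].
apply: (above_Jg g0 (JgI g) gg (J1 g0)).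
exact: sI (JgI g) (@JJg g) (adm_above g0 (JgI g) gg (J1 g0)) gu _ ts.
Qed.

Lemma notin_Jg u : ~ J u -> exists2 p : {poly K}, p != 0 &
  forall g, g != 0 -> p.[g] != 0 -> ~ Jg g u.
Proof.
move=> Ju; have [s [us sI]] := expansion u.
have [/allP s0|/allPn[t ts t0]] := boolP (all (fun t => t.1 == 0) s).
  case: Ju; apply: (ideal_subr JI us); apply: (ideal_sum JI) => t /s0/eqP->.
  by rewrite raddf0 mul0r; exact: (two_sided_ideal0 JI).
exists t.1 => // g g0 pg gu.
by move/eqP: pg; apply; apply: expansion_Jg sI ts gu.
Qed.

Lemma bigcap_Jg : \bigcap_(g in [set g | g != 0]) Jg g `<=` J.
Proof.
move=> u uJ; have [//|/notin_Jg[p p0 pJ]] := pselect (J u).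
by have [g g0 pg] := poly_nonroot p0; case: (pJ g g0 pg); apply: uJ.
Qed.

Lemma J_prime : prime_ideal J.
Proof.
split=> //.
  apply: ideal_proper => // /(JJg (g := 1)).
  by apply: J1; rewrite oner_eq0.
move=> I1 I2 II1 II2 I12.
have [?|/existsNP[f /not_implyP[If /notin_Jg[p p0 pf]]]] := pselect (I1 `<=` J); first by left.
have [?|/existsNP[f' /not_implyP[If' /notin_Jg[p' p'0 pf']]]] := pselect (I2 `<=` J).
  by right.
have [g g0] : exists2 g, g != 0 & (p * p').[g] != 0 by apply: poly_nonroot; rewrite mulf_neq0.
rewrite hornerM mulf_eq0 negb_or => /andP[pg p'g].
have [_ _ /(_ I1 I2 II1 II2)[x y Ix Iy|I1g|I2g]] := Jg_prime g0.
- exact: (JJg (I12 _ _ Ix Iy)).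
- by case: (pf g g0 pg); apply: I1g.
- by case: (pf' g g0 p'g); apply: I2g.
Qed.

Let nJ : forall m, [set n] m -> weight_vector m. Proof. by move=> m ->. Qed.

Lemma bigcap_act_Jg g : g != 0 -> \bigcap_(h in @torus K) (act h @` Jg g) = J.
Proof.
move=> g0; apply/seteqP; split; last exact: weight_ideal_sub_bigcap.
move=> u uJ; apply: bigcap_Jg => g' /= g'0.
have [h ht hg] : exists2 h, torus h & chi h = g / g'.
  by apply: chi_surj; rewrite mulf_neq0 ?invr_neq0.
have [v gv <-] := uJ h ht; move: v gv.
apply: ideal_gen_min (act_preimage_ideal h (JgI g')) _ => m [->|->] /=.
  by have [e ->] := nw ht; apply: (two_sided_idealZ (JgI g')); apply: ideal_gen_sub; left.
have -> : act h (c - g%:A) = (g / g') *: (c - g'%:A).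
  by rewrite raddfB /= cw // hg linearZ /= rmorph1 scalerBr scalerA divfK.
exact: (two_sided_idealZ (JgI g')).
Qed.

Lemma central_stratum : strat J = [set J] `|` [set Jg g | g in [set g : K | g != 0]].
Proof.
apply/seteqP; split=> [P PJ|P [->|[g g0 <-]]]; first last.
- by split; [exact: Jg_prime|exact: bigcap_act_Jg].
- by split; [exact: J_prime|exact: weight_ideal_bigcap].
have [Pp PE] := PJ; have PI := prime_ideal_ideal Pp; have JP := strat_sub PJ.
have P1 := prime_ideal1 Pp.
have [[p p0 Pcp]|Pc] := pselect (exists2 p, p != 0 & P (horner_alg c p)).
  have [u|g Pg] := prime_central_root Pp _ p0 Pcp; first exact/JP.
  have JgP : Jg g `<=` P.
    apply: (ideal_gen_min PI) => _ [->|->] //.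
    by apply: JP; apply: ideal_gen_sub.
  have g0 : g != 0.
    apply/eqP => gE; rewrite gE scale0r subr0 in Pg.
    have Jc : J c.
      apply: (strat_weight (S := [set c]) PI _ PE) => // m -> // h ht.
      by exists (chi h); apply: cw.
    have g1 : (1 : K) != 0 by rewrite oner_eq0.
    apply: (J1 g1); rewrite -[X in Jg 1 X]scale1r.
    by apply: (ideal_subl (JgI 1) (@Jgc 1)); apply: JJg.
  by right; exists g => //; apply/seteqP; split=> //; apply: Jg_maximal.
left; apply/seteqP; split=> // u Pu; have [s [us sI]] := expansion u.
apply: (ideal_subr JI us); apply: (ideal_sum JI) => t ts.
have [->|t0] := eqVneq t.1 0; first by rewrite raddf0 mul0r; exact: (two_sided_ideal0 JI).
by case: Pc; exists t.1 => //; apply: sI ts => //; apply: adm_stratum.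
Qed.

End CentralStratum.
End Strata.

(** * Representations on sequences *)

Section Representation.
Variables (K : fieldType) (q al be : K).
Hypotheses (q0 : q != 0) (q4 : q ^+ 4 != 1).

Let c := (q ^+ 2 - q ^- 2)^-1.
Let ra (n : int) : K := al * (q ^+ 2) ^ (- n).
Let rb (n : int) : K := be * (q ^+ 2) ^ n.
Let g (n : int) : K := c * (rb n - ra n).

Definition rep_x : seqop K := mulshift (fun=> 1) 1.
Definition rep_y : seqop K := mulshift g (-1).
Definition rep_a : seqop K := mulshift ra 0.
Definition rep_b : seqop K := mulshift rb 0.

Let r0 : q ^+ 2 != 0. Proof. by rewrite expf_neq0. Qed.

Let raS n : ra (n + 1) = q ^- 2 * ra n.
Proof. by rewrite /ra opprD expfzDr // mulrA [LHS]mulrC. Qed.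
Let raP n : ra (n - 1) = q ^+ 2 * ra n.
Proof. by rewrite -[in RHS](subrK 1 n) raS mulrA mulfV // mul1r. Qed.
Let rbS n : rb (n + 1) = q ^+ 2 * rb n.
Proof. by rewrite /rb expfzDr // expr1z [RHS]mulrCA [q ^+ 2 * _]mulrC. Qed.
Let rbP n : rb (n - 1) = q ^- 2 * rb n.
Proof. by rewrite -[in RHS](subrK 1 n) rbS mulrA mulVf // mul1r. Qed.

Let expand := (@seqopD K, @seqopN K, @seqopZ K, @seqopM K, @seqop0 K, @mulshiftE K, @mul1r K).

Lemma rep_serre1 : serre1 q rep_x rep_y = 0.
Proof.
apply: seqop_eq_at => f n; rewrite /serre1 !expr2 !expand ?addrK ?subrK.
by rewrite /g !raS !rbS; move: c (ra n) (rb n) (f _) => *; field.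
Qed.

Lemma rep_serre2 : serre2 q rep_x rep_y = 0.
Proof.
apply: seqop_eq_at => f n; rewrite /serre2 !exprS !expr0 !mulr1 !expand ?addrK ?subrK.
by rewrite /g !(raS, rbS, raP, rbP); move: c (ra n) (rb n) (f _) => *; field.
Qed.

Let cK : c * (q ^+ 2 - q ^- 2) = 1.
Proof. by rewrite mulVf // q2_neq_q2V. Qed.

Lemma rep_e3 : rep_x * rep_y - q ^+ 2 *: (rep_y * rep_x) = rep_a.
Proof.
apply: seqop_eq_at => f n; rewrite !expand ?addrK ?subrK addr0.
rewrite -[RHS]mul1r -cK /g !(raS, rbS, raP, rbP).
by move: c (ra n) (rb n) (f _) => *; field.
Qed.

Lemma rep_e3bar : rep_x * rep_y - q ^- 2 *: (rep_y * rep_x) = rep_b.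
Proof.
apply: seqop_eq_at => f n; rewrite !expand ?addrK ?subrK addr0.
rewrite -[RHS]mul1r -cK /g !(raS, rbS, raP, rbP).
by move: c (ra n) (rb n) (f _) => *; field.
Qed.

Lemma rep_z : rep_y * rep_a - q ^+ 2 *: (rep_a * rep_y) = 0.
Proof.
apply: seqop_eq_at => f n; rewrite !expand !addr0 /g !(raS, rbS, raP, rbP).
by move: c (ra n) (rb n) (f _) => *; field.
Qed.

Lemma rep_ab : rep_a * rep_b = (al * be)%:A.
Proof.
apply: seqop_eq_at => f n; rewrite !expand seqop1 !addr0 mulrA /ra /rb.
by rewrite mulrACA -expfzDr // addNr mulr1.
Qed.

Lemma rep_b_pow N : (rep_b ^+ N) (fun=> 1) 0 = be ^+ N.
Proof.
elim: N => [|N IHN]; first by rewrite !expr0 seqop1.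
by rewrite !exprS seqopM mulshiftE addr0 IHN /rb mulr1.
Qed.

Lemma rep_a_pow N : (rep_a ^+ N) (fun=> 1) 0 = al ^+ N.
Proof.
elim: N => [|N IHN]; first by rewrite !expr0 seqop1.
by rewrite !exprS seqopM mulshiftE addr0 IHN /ra oppr0 mulr1.
Qed.

End Representation.

(** * The strata of the ideals containing z *)

Section UqB2Strata.
Variables (K : numClosedFieldType) (q : K).
Hypotheses (q0 : q != 0) (q1 : forall n, (0 < n)%N -> q ^+ n != 1).
Variables (U : algType K) (x y : U).
Hypothesis HU : is_UqB2 q x y.
Variable act : K * K -> {lrmorphism U -> U}.
Hypothesis act1 : forall u, act (1, 1) u = u.
Hypothesis actM : forall h k u, act h (act k u) = act (h.1 * k.1, h.2 * k.2) u.
Hypothesis act_x : forall h, act h x = h.1 *: x.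
Hypothesis act_y : forall h, act h y = h.2 *: y.
Variables a b w t : U.
Hypothesis aE : a = x * y - q ^+ 2 *: (y * x).
Hypothesis bE : b = x * y - q ^- 2 *: (y * x).
Hypothesis wE : w = y * a - q ^+ 2 *: (a * y).
Hypothesis tE : t = (1 - q ^- 2) *: (a * b + (1 + q ^- 2) *: (w * x)).

Let q4 : q ^+ 4 != 1. Proof. exact: q1. Qed.
Let r := q ^+ 2.
Let c := (q ^+ 2 - q ^- 2)^-1.
Let d := 1 - q ^- 2.
Let r0 : r != 0. Proof. by rewrite expf_neq0. Qed.
Let r1 n : (0 < n)%N -> r ^+ n != 1.
Proof. by move=> n0; rewrite -exprM q1 // muln_gt0. Qed.
Let c0 : c != 0. Proof. by rewrite invr_neq0 // q2_neq_q2V. Qed.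
Let d0 : d != 0.
Proof.
rewrite subr_eq0 eq_sym -[X in _ != X]invr1 (inj_eq invr_inj); exact: q1.
Qed.

Section Morphism.
Variables (A : algType K) (f : {lrmorphism U -> A}).
Hypothesis fw : f w = 0.

Lemma UqB2_weyl_rel : weyl_rel r c c (f x) (f y) (f a) (f b).
Proof.
have s1 : serre1 q (f x) (f y) = 0 by rewrite -serre1_morph (UqB2_serre1 HU) raddf0.
have fa : f a = f x * f y - q ^+ 2 *: (f y * f x) by rewrite aE rmorph_qcomm.
have fb : f b = f x * f y - q ^- 2 *: (f y * f x) by rewrite bE rmorph_qcomm.
have := rmorph_qcomm f (q ^+ 2) y a; rewrite -wE fw => /esym/eqP; rewrite subr_eq0.
move: (f x) (f y) (f a) (f b) fa fb s1 => u v a' b' -> -> s1 /eqP.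
exact: serre_weyl_rel.
Qed.

Lemma UqB2_weyl_t : f t = d *: (f a * f b).
Proof. by rewrite tE; apply: rmorph_z'. Qed.

End Morphism.

Lemma morph_kernel_sub (A : algType K) (f : {lrmorphism U -> A}) (S : set U) :
  (forall s, S s -> f s = 0) -> forall u, ideal_gen S u -> f u = 0.
Proof.
move=> Sf; have kI : two_sided_ideal [set u | f u = 0].
  split=> [|u v /= fu fv|u v /= fv|u v /= fv]; first exact: raddf0.
  - by rewrite raddfD /= fu fv addr0.
  - by rewrite rmorphM /= fv mulr0.
  - by rewrite rmorphM /= fv mul0r.
exact: (ideal_gen_min kI).
Qed.

Lemma morph_gen_proper (A : algType K) (f : {lrmorphism U -> A}) (S : set U) :
  (forall s, S s -> f s = 0) -> ~ ideal_gen S 1.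
Proof. by move=> Sf /(morph_kernel_sub Sf)/eqP; rewrite rmorph1 oner_eq0. Qed.

Lemma UqB2_rep (al be : K) : exists f : {lrmorphism U -> seqop K},
  [/\ f a = rep_a q al, f b = rep_b q be, f w = 0 & f t = (d * (al * be))%:A].
Proof.
have [f [fx fy]] := UqB2_univ HU (rep_serre1 al be q0) (rep_serre2 al be q0).
have fa : f a = rep_a q al by rewrite aE rmorph_qcomm fx fy rep_e3.
have fb : f b = rep_b q be by rewrite bE rmorph_qcomm fx fy rep_e3bar.
have fw : f w = 0 by rewrite wE rmorph_qcomm fa fy rep_z.
by exists f; split=> //; rewrite (UqB2_weyl_t fw) fa fb rep_ab // scalerA.
Qed.

Local Notation Z := (ideal_gen [set w]).
Let ZI : two_sided_ideal Z. Proof. exact: ideal_gen_ideal. Qed.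

Let nf (S : seq (int * int)) (p : int * int -> {poly K}) :=
  \sum_(s <- S) horner_alg t (p s) * int_pow a b s.1 * int_pow x y s.2.

Lemma rmorph_horner_alg (A : algType K) (f : {lrmorphism U -> A}) (v : U) p :
  f (horner_alg v p) = horner_alg (f v) p.
Proof.
elim/poly_ind: p => [|p e IHp]; first by rewrite !raddf0.
rewrite rmorphD rmorphM [in RHS]rmorphD [in RHS]rmorphM /= !horner_algC !horner_algX.
by rewrite rmorphD rmorphM /= IHp linearZ /= rmorph1.
Qed.

Lemma rmorph_int_pow (A : algType K) (f : {lrmorphism U -> A}) (u v : U) k :
  f (int_pow u v k) = int_pow (f u) (f v) k.
Proof. by case: k => k; apply: rmorphXn. Qed.

Lemma rmorph_nf (A : algType K) (f : {lrmorphism U -> A}) S p :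
  f (nf S p) = \sum_(s <- S)
    horner_alg (f t) (p s) * int_pow (f a) (f b) s.1 * int_pow (f x) (f y) s.2.
Proof.
rewrite raddf_sum /=; apply: eq_bigr => s _.
by rewrite !rmorphM /= rmorph_horner_alg !rmorph_int_pow.
Qed.

Lemma UqB2_normal_form u : exists S p, uniq S /\ Z (u - nf S p).
Proof.
have [f [_ _ fw _]] := UqB2_rep 0 0.
have Z1 : ~ Z 1 by apply: (morph_gen_proper (f := f)) => _ ->.
have [B [g [_ gZ]]] := ideal_quotient ZI Z1.
have gw : g w = 0 by apply/gZ; apply: ideal_gen_sub.
have W := UqB2_weyl_rel gw.
pose Sp := wspan (g x) (g y) (g a) (g b).
have : Sp (g u).
  have /(_ 1) : forall h, Sp h -> Sp (h * g u).
    move: u; apply: (UqB2_ind HU (P := fun u => forall h, Sp h -> Sp (h * g u))) =>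
      [e h|h|h|u v Hu Hv h hS|u v Hu Hv h hS].
    - by rewrite linearZ /= rmorph1 mulr_algr; apply: wspanZ.
    - exact: (wspanMu W r0).
    - exact: (wspanMv W).
    - by rewrite raddfD mulrDr; apply: wspanD; [apply: Hu|apply: Hv].
    - by rewrite rmorphM mulrA; apply/Hv/Hu.
  rewrite mul1r; apply.
  by have := wspan_mono (g x) (g y) (g a) (g b) 0 0 0; rewrite !mulr1.
case/(wspan_normal_form W d0) => S [p [Su gu]]; exists S, p; split=> //.
by apply/gZ; rewrite raddfB /= rmorph_nf UqB2_weyl_t // gu subrr.
Qed.

Lemma UqB2_normal_form_ideal (I : set U) S p : two_sided_ideal I -> I w -> ~ I 1 ->
  (forall u, I (u * a) -> I u) \/ (forall u, I (u * b) -> I u) ->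
  uniq S -> I (nf S p) -> {in S, forall s, I (horner_alg t (p s) * int_pow a b s.1)}.
Proof.
move=> II Iw I1 reg Su InfS s sS.
have [B [g [gs gI]]] := ideal_quotient II I1.
have gw : g w = 0 by apply/gI.
have W := UqB2_weyl_rel gw.
have regB n : (forall u, I (u * n) -> I u) -> rregular (g n).
  by move=> In h; have [u <-] := gs h; rewrite -rmorphM => /gI/In/gI.
have regAB : rregular (g a) \/ rregular (g b) by case: reg => /regB; [left|right].
apply/gI; rewrite rmorphM /= rmorph_horner_alg rmorph_int_pow (UqB2_weyl_t gw).
apply: (weyl_normal_form_unique W r0 c0 c0 r1 Su regAB _ sS).
by rewrite -(UqB2_weyl_t gw) -rmorph_nf; apply/gI.
Qed.

Lemma UqB2_normal J n e e' : two_sided_ideal J ->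
  J (x * n - e *: (n * x)) -> J (y * n - e' *: (n * y)) -> normal_mod J n.
Proof.
move=> JI xn yn u; move: u.
apply: (UqB2_ind HU (P := fun u => exists u', J (u * n - n * u'))) =>
  [k|||u v [u' uu'] [v' vv']|u v [u' uu'] [v' vv']].
- by exists k%:A; rewrite mulr_algl mulr_algr subrr; apply: two_sided_ideal0.
- by exists (e *: x); rewrite -scalerAr.
- by exists (e' *: y); rewrite -scalerAr.
- exists (u' + v'); rewrite mulrDl mulrDr opprD addrACA.
  exact: two_sided_idealD.
exists (u' * v').
have -> : u * v * n - n * (u' * v') =
    u * (v * n - n * v') + (u * n - n * u') * v'.
  by rewrite mulrBr mulrBl !mulrA addrA subrK.
by apply: two_sided_idealD => //; [apply: two_sided_idealMl|apply: two_sided_idealMr].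
Qed.

Let xa : x * a = q ^- 2 *: (a * x).
Proof. by rewrite aE serre1_e3 // (UqB2_serre1 HU) addr0. Qed.
Let xb : x * b = q ^+ 2 *: (b * x).
Proof. by rewrite bE serre1_e3bar // (UqB2_serre1 HU) addr0. Qed.
Let ya : y * a = q ^+ 2 *: (a * y) + w.
Proof. by rewrite wE addrC subrK. Qed.
Let yb : y * b = q ^- 2 *: (b * y) + q ^- 4 *: w.
Proof. by rewrite wE aE bE z_e3bar. Qed.

Lemma e3_normal J : two_sided_ideal J -> J w -> normal_mod J a.
Proof.
move=> JI Jw; apply: (UqB2_normal (e := q ^- 2) (e' := q ^+ 2) JI).
  by rewrite xa subrr; apply: two_sided_ideal0.
by rewrite ya addrAC subrr add0r.
Qed.

Lemma e3bar_normal J : two_sided_ideal J -> J w -> normal_mod J b.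
Proof.
move=> JI Jw; apply: (UqB2_normal (e := q ^+ 2) (e' := q ^- 2) JI).
  by rewrite xb subrr; apply: two_sided_ideal0.
by rewrite yb addrAC subrr add0r; apply: two_sided_idealZ.
Qed.

Lemma act_qcomm h k : act h (x * y - k *: (y * x)) = (h.1 * h.2) *: (x * y - k *: (y * x)).
Proof.
rewrite rmorph_qcomm act_x act_y -!scalerAl -!scalerAr scalerBr !scalerA.
by congr (_ *: _ - _ *: _); ring.
Qed.
Lemma act_a h : act h a = (h.1 * h.2) *: a.
Proof. by rewrite aE act_qcomm. Qed.
Lemma act_b h : act h b = (h.1 * h.2) *: b.
Proof. by rewrite bE act_qcomm. Qed.
Lemma act_w h : act h w = (h.1 * h.2 ^+ 2) *: w.
Proof.
rewrite wE rmorph_qcomm act_y act_a -!scalerAl -!scalerAr scalerBr !scalerA.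
by congr (_ *: _ - _ *: _); ring.
Qed.
Lemma act_t h : act h t = (h.1 ^+ 2 * h.2 ^+ 2) *: t.
Proof.
rewrite tE linearZ raddfD /= linearZ /= !rmorphM /= act_w act_a act_b act_x.
rewrite -!scalerAl -!scalerAr !scalerDr !scalerA.
by congr (_ *: _ + _ *: _); ring.
Qed.

Lemma saturated_core m n : n = a \/ n = b ->
  let J := ideal_gen [set m] in J w -> J t ->
  (forall k, J (int_pow a b k) \/ exists j, int_pow a b k = n ^+ j) ->
  forall I, two_sided_ideal I -> J `<=` I -> ~ I 1 ->
    (forall u, I (u * n) -> I u) -> I `<=` J.
Proof.
move=> nab J Jw Jt JM I II JIs I1 reg u Iu.
have JI : two_sided_ideal J := ideal_gen_ideal _.
have ZJ : Z `<=` J by apply: (ideal_gen_min JI) => _ ->.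
have [S [p [Su uS]]] := UqB2_normal_form u.
have InfS : I (nf S p) by apply: (ideal_subl II (JIs _ (ZJ _ uS))).
have regab : (forall u, I (u * a) -> I u) \/ (forall u, I (u * b) -> I u).
  by case: nab => <-; [left|right].
apply: (ideal_subr JI (ZJ _ uS)); apply: (ideal_sum JI) => s sS.
apply: (two_sided_idealMr JI).
have := UqB2_normal_form_ideal II (JIs _ Jw) I1 regab Su InfS sS.
have [JMs _|[j ->] Ihj] := JM s.1; first exact: (two_sided_idealMl JI).
apply: (two_sided_idealMr JI).
have Ih : I (horner_alg t (p s)).
  elim: j Ihj => [|j IHj]; first by rewrite expr0 mulr1.
  by rewrite exprSr mulrA => /reg.
have t0 (I' : set U) : I' t -> I' (t - 0%:A) by rewrite scale0r subr0.
have p0 : (p s).[0] = 0.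
  apply: (ideal_scalar II I1); apply: (ideal_subl II _ Ih).
  exact: (ideal_horner II _ (t0 _ (JIs _ Jt))).
by have := ideal_horner JI (p s) (t0 _ Jt); rewrite p0 scale0r subr0.
Qed.

Lemma e3_stratum : strat act (ideal_gen [set a]) = [set ideal_gen [set a]].
Proof.
have JI : two_sided_ideal (ideal_gen [set a]) := ideal_gen_ideal _.
have Ja : ideal_gen [set a] a by apply: ideal_gen_sub.
have Jw : ideal_gen [set a] w.
  rewrite wE; apply: (two_sided_idealB JI); first exact: (two_sided_idealMl JI _ Ja).
  exact: (two_sided_idealZ JI _ (two_sided_idealMr JI _ Ja)).
have Jt : ideal_gen [set a] t.
  rewrite tE; apply: (two_sided_idealZ JI); apply: (two_sided_idealD JI).
    exact: (two_sided_idealMr JI _ Ja).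
  exact: (two_sided_idealZ JI _ (two_sided_idealMr JI _ Jw)).
apply: (saturated_stratum act1 actM (n := b)).
- by move=> h _; exists (h.1 * h.2); apply: act_a.
- by move=> h _; exists (h.1 * h.2); apply: act_b.
- exact: e3bar_normal.
- move=> N JbN; have [f [fa fb _ _]] := UqB2_rep 0 1.
  have fa0 : f a = 0.
    by rewrite fa; apply: seqop_eq_at => g n; rewrite mulshiftE !mul0r.
  have : f (b ^+ N) = 0 by apply: (morph_kernel_sub (f := f) _ JbN) => _ ->.
  rewrite rmorphXn /= fb => /(congr1 (fun T : seqop K => T (fun=> 1) 0)) /eqP.
  by rewrite rep_b_pow expr1n oner_eq0.
apply: saturated_core => //; first by right.
case=> [[|k]|k]; [right|left|right].
- by exists 0%N.
- by rewrite /= exprS; exact: (two_sided_idealMr JI _ Ja).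
by exists k.+1.
Qed.

Lemma e3bar_stratum : strat act (ideal_gen [set b]) = [set ideal_gen [set b]].
Proof.
have JI : two_sided_ideal (ideal_gen [set b]) := ideal_gen_ideal _.
have Jb : ideal_gen [set b] b by apply: ideal_gen_sub.
have Jw : ideal_gen [set b] w.
  rewrite -[w](scalerKV (expf_neq0 4 q0)); apply: (two_sided_idealZ JI).
  have -> : q ^- 4 *: w = y * b - q ^- 2 *: (b * y) by rewrite yb addrAC subrr add0r.
  apply: (two_sided_idealB JI); first exact: (two_sided_idealMl JI _ Jb).
  exact: (two_sided_idealZ JI _ (two_sided_idealMr JI _ Jb)).
have Jt : ideal_gen [set b] t.
  rewrite tE; apply: (two_sided_idealZ JI); apply: (two_sided_idealD JI).
    exact: (two_sided_idealMl JI _ Jb).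
  exact: (two_sided_idealZ JI _ (two_sided_idealMr JI _ Jw)).
apply: (saturated_stratum act1 actM (n := a)).
- by move=> h _; exists (h.1 * h.2); apply: act_b.
- by move=> h _; exists (h.1 * h.2); apply: act_a.
- exact: e3_normal.
- move=> N JaN; have [f [fa fb _ _]] := UqB2_rep 1 0.
  have fb0 : f b = 0.
    by rewrite fb; apply: seqop_eq_at => g n; rewrite mulshiftE !mul0r.
  have : f (a ^+ N) = 0 by apply: (morph_kernel_sub (f := f) _ JaN) => _ ->.
  rewrite rmorphXn /= fa => /(congr1 (fun T : seqop K => T (fun=> 1) 0)) /eqP.
  by rewrite rep_a_pow expr1n oner_eq0.
apply: saturated_core => //; first by left.
case=> k; [right|left]; first by exists k.
by rewrite /= exprS; exact: (two_sided_idealMr JI _ Jb).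
Qed.

Lemma t_central u : Z (t * u - u * t).
Proof.
have [f [_ _ fw _]] := UqB2_rep 0 0.
have Z1 : ~ Z 1 by apply: (morph_gen_proper (f := f)) => _ ->.
have [B [g [_ gZ]]] := ideal_quotient ZI Z1.
have gw : g w = 0 by apply/gZ; apply: ideal_gen_sub.
have [xt yt _ _] := weyl_central (UqB2_weyl_rel gw) r0 d.
have qc h : qcomm 1 h (g t) -> g t * h = h * g t by rewrite /qcomm scale1r.
move: xt yt; rewrite -(UqB2_weyl_t gw) => /qc xt /qc yt.
apply/gZ; rewrite raddfB /= !rmorphM; apply/eqP; rewrite subr_eq0; apply/eqP.
move: u; apply: (UqB2_ind HU (P := fun u => g t * g u = g u * g t)) =>
  [k|||u v gu gv|u v gu gv] //.
- by rewrite linearZ /= rmorph1 mulr_algr mulr_algl.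
- by rewrite raddfD mulrDr mulrDl gu gv.
by rewrite rmorphM mulrA gu -!mulrA gv.
Qed.

Lemma z_stratum : strat act (ideal_gen [set w]) =
  [set ideal_gen [set w]] `|`
  [set ideal_gen [set w; t - g%:A] | g in [set g : K | g != 0]].
Proof.
pose adm I := (forall u, I (u * a) -> I u) /\ (forall u, I (u * b) -> I u).
apply: (central_stratum act1 actM (adm := adm) (chi := fun h => h.1 ^+ 2 * h.2 ^+ 2)).
- by move=> h _; exists (h.1 * h.2 ^+ 2); apply: act_w.
- by move=> h _; apply: act_t.
- move=> g g0; exists (sqrtC g, 1); last by rewrite /= sqrtCK expr1n mulr1.
  by split; rewrite /= ?sqrtC_eq0 ?oner_eq0.
- exact: t_central.
- move=> g g0; have [f [_ _ fw ft]] := UqB2_rep (g / d) 1.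
  apply: (morph_gen_proper (f := f)) => _ [->|->] //.
  by rewrite raddfB /= ft linearZ /= rmorph1 mulr1 mulrC divfK // subrr.
- move=> g I g0 II JI I1; have [B [f [_ fI]]] := ideal_quotient II I1.
  have fw : f w = 0 by apply/fI; apply: JI; apply: ideal_gen_sub; left.
  have ft : f t = g%:A.
    have : f (t - g%:A) = 0 by apply/fI; apply: JI; apply: ideal_gen_sub; right.
    by rewrite raddfB /= linearZ /= rmorph1 => /eqP; rewrite subr_eq0 => /eqP.
  have gd0 : g / d != 0 by rewrite mulf_neq0 // invr_neq0.
  have fab : f a * f b = (g / d)%:A.
    by rewrite mulrC -scalerA -ft (UqB2_weyl_t fw) scalerK.
  have fba : f b * f a = (g / d)%:A by rewrite -fab; case: (UqB2_weyl_rel fw).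
  split=> u /fI; rewrite rmorphM => fu; apply/fI/eqP.
    by rewrite -(inj_eq (scalerI gd0)) scaler0 -mulr_algr -fab mulrA fu mul0r.
  by rewrite -(inj_eq (scalerI gd0)) scaler0 -mulr_algr -fba mulrA fu mul0r.
- move=> P PJ; have [Pp PE] := PJ; have JP := strat_sub act1 PJ.
  have PI := prime_ideal_ideal Pp.
  have Pw : P w by apply: JP; apply: ideal_gen_sub.
  have [f [fa fb fw _]] := UqB2_rep 1 1.
  have at1 (T : seqop K) : T = 0 -> T (fun=> 1) 0 = 0 by move=> ->.
  have Pa : ~ P a.
    move=> Pa; have Za : Z a.
      have mw k : [set a] k -> weight_vector act k.
        by move=> -> h _; exists (h.1 * h.2); apply: act_a.
      have mP : [set a] `<=` P by move=> _ ->.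
      exact: (strat_weight act1 actM PI mw PE mP erefl).
    have /at1/eqP : f a = 0 by apply: (morph_kernel_sub (f := f) _ Za) => _ ->.
    by rewrite fa -[rep_a _ _]expr1 rep_a_pow expr1 oner_eq0.
  have Pb : ~ P b.
    move=> Pb; have Zb : Z b.
      have mw k : [set b] k -> weight_vector act k.
        by move=> -> h _; exists (h.1 * h.2); apply: act_b.
      have mP : [set b] `<=` P by move=> _ ->.
      exact: (strat_weight act1 actM PI mw PE mP erefl).
    have /at1/eqP : f b = 0 by apply: (morph_kernel_sub (f := f) _ Zb) => _ ->.
    by rewrite fb -[rep_b _ _]expr1 rep_b_pow expr1 oner_eq0.
  have Zw : Z w by apply: ideal_gen_sub.
  split; first exact: (prime_rregular (e3_normal ZI Zw) Pp JP Pa).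
  exact: (prime_rregular (e3bar_normal ZI Zw) Pp JP Pb).
move=> u; have [S [p [Su uS]]] := UqB2_normal_form u.
exists [seq (p s, int_pow a b s.1 * int_pow x y s.2) | s <- S]; split.
  rewrite big_map; congr (ideal_gen _ (u - _)): uS.
  by apply: eq_bigr => s _; rewrite mulrA.
move=> I II ZIs [Ia Ib] Iu _ /mapP[s sS ->] /=.
have [I1|I1] := pselect (I 1); first by rewrite -[horner_alg _ _]mulr1; apply: two_sided_idealMl.
have InfS : I (nf S p) by apply: (ideal_subl II (ZIs _ uS)).
have Iw : I w by apply: ZIs; apply: ideal_gen_sub.
have {InfS} := UqB2_normal_form_ideal II Iw I1 (or_introl Ia) Su InfS sS.
have key n : (forall u, I (u * n) -> I u) -> forall h k, I (h * n ^+ k) -> I h.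
  move=> In h; elim=> [|k IHk]; first by rewrite expr0 mulr1.
  by rewrite exprSr mulrA => /In.
by case: (s.1) => k; [apply: (key a)|apply: (key b)].
Qed.

Lemma UqB2_character (al be : K) : al * be = 0 ->
  exists f : {lrmorphism U -> K^o}, f x = al /\ f y = be.
Proof.
move=> ab0; apply: (UqB2_univ HU).
  rewrite /serre1 /GRing.scale /=.
  by transitivity ((al * be) * (2 - (q ^+ 2 + q ^- 2)) * al); [ring|rewrite ab0 !mul0r].
rewrite /serre2 /GRing.scale /=.
by transitivity ((al * be) * 0); [ring|rewrite mulr0].
Qed.

Lemma axis_stratum n m (chi : K * K -> K) :
  (n = x /\ m = y) \/ (n = y /\ m = x) ->
  (forall h, torus h -> exists k : K, act h n = k *: n) ->
  (forall h, torus h -> act h m = chi h *: m) ->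
  (forall g, g != 0 -> exists2 h, torus h & chi h = g) ->
  (forall g : K, exists f : {lrmorphism U -> K^o}, f n = 0 /\ f m = g) ->
  strat act (ideal_gen [set n]) =
  [set ideal_gen [set n]] `|`
  [set ideal_gen [set n; m - g%:A] | g in [set g : K | g != 0]].
Proof.
move=> nm nw mw chi_surj char.
have JI : two_sided_ideal (ideal_gen [set n]) := ideal_gen_ideal _.
have Jn : ideal_gen [set n] n by apply: ideal_gen_sub.
have expand u : exists p, ideal_gen [set n] (u - horner_alg m p).
  have En : exists p, ideal_gen [set n] (n - horner_alg m p).
    by exists 0; rewrite raddf0 subr0.
  have Em : exists p, ideal_gen [set n] (m - horner_alg m p).
    by exists 'X; rewrite horner_algX subrr; apply: (two_sided_ideal0 JI).
  move: u; apply: (UqB2_ind HU (P := fun u => exists p, ideal_gen [set n] (u - horner_alg m p))) =>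
    [k|||u v [p up] [p' vp]|u v [p up] [p' vp]].
  - by exists k%:P; rewrite horner_algC subrr; apply: (two_sided_ideal0 JI).
  - by case: nm => -[nE mE]; rewrite -?nE -?mE.
  - by case: nm => -[nE mE]; rewrite -?nE -?mE.
  - exists (p + p'); rewrite raddfD opprD addrACA.
    exact: (two_sided_idealD JI).
  exists (p * p'); rewrite rmorphM.
  have -> : u * v - horner_alg m p * horner_alg m p' =
      u * (v - horner_alg m p') + (u - horner_alg m p) * horner_alg m p'.
    by rewrite mulrBr mulrBl addrA subrK.
  apply: (two_sided_idealD JI); first exact: (two_sided_idealMl JI _ vp).
  exact: (two_sided_idealMr JI _ up).
apply: (central_stratum act1 actM (adm := fun=> True) (chi := chi)) => //.
- move=> u; have [p up] := expand u.
  have pm : m * horner_alg m p = horner_alg m p * m.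
    by have := @qcomm_horner _ _ m m p; rewrite /qcomm !scale1r => ->.
  have -> : m * u - u * m = m * (u - horner_alg m p) - (u - horner_alg m p) * m.
    by rewrite mulrBr mulrBl pm opprB addrA subrK.
  apply: (two_sided_idealB JI); first exact: (two_sided_idealMl JI _ up).
  exact: (two_sided_idealMr JI _ up).
- move=> g _; have [f [fn fm]] := char g.
  apply: (morph_gen_proper (f := f)) => _ [->|->] //.
  by rewrite raddfB /= fm linearZ /= rmorph1 /GRing.scale /= mulr1 subrr.
move=> u; have [p up] := expand u; exists [:: (p, 1)]; split.
  by rewrite big_seq1 mulr1.
move=> I II JIs _ Iu t'; rewrite inE => /eqP-> /=.
exact: (ideal_subl II (JIs _ up)).
Qed.

Lemma e1_stratum : strat act (ideal_gen [set x]) =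
  [set ideal_gen [set x]] `|`
  [set ideal_gen [set x; y - g%:A] | g in [set g : K | g != 0]].
Proof.
apply: (axis_stratum (chi := snd)) => [|h _|h _|g g0|g].
- by left.
- by exists h.1.
- exact: act_y.
- by exists (1, g) => //; split; rewrite //= oner_eq0.
by apply: UqB2_character; rewrite mul0r.
Qed.

Lemma e2_stratum : strat act (ideal_gen [set y]) =
  [set ideal_gen [set y]] `|`
  [set ideal_gen [set x - g%:A; y] | g in [set g : K | g != 0]].
Proof.
under eq_imagel => g _ do rewrite setUC.
apply: (axis_stratum (chi := fst)) => [|h _|h _|g g0|g].
- by right.
- by exists h.2.
- exact: act_x.
- by exists (g, 1) => //; split; rewrite //= oner_eq0.
have [f [fx fy]] := UqB2_character (mulr0 g).
by exists f.
Qed.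

Lemma e1e2_stratum : strat act (ideal_gen [set x; y]) = [set ideal_gen [set x; y]].
Proof.
set J := ideal_gen _; have JI : two_sided_ideal J := ideal_gen_ideal _.
have Jx : J x by apply: ideal_gen_sub; left.
have Jy : J y by apply: ideal_gen_sub; right.
have [f [fx fy]] := UqB2_character (mulr0 0).
have J1 : ~ J 1 by apply: (morph_gen_proper (f := f)) => _ [->|->].
have Jw k : [set x; y] k -> weight_vector act k.
  by move=> [->|->] h _; [exists h.1|exists h.2].
have expand u : exists k : K, J (u - k%:A).
  move: u; apply: (UqB2_ind HU (P := fun u => exists k : K, J (u - k%:A))) =>
    [k|||u v [k uk] [k' vk]|u v [k uk] [k' vk]].
  - by exists k; rewrite subrr; apply: (two_sided_ideal0 JI).
  - by exists 0; rewrite scale0r subr0.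
  - by exists 0; rewrite scale0r subr0.
  - by exists (k + k'); rewrite scalerDl opprD addrACA; apply: (two_sided_idealD JI).
  exists (k * k'); have -> : u * v - (k * k')%:A = u * (v - k'%:A) + (u - k%:A) * k'%:A.
    by rewrite mulrBr mulrBl addrA subrK -scalerAl mul1r scalerA.
  apply: (two_sided_idealD JI); first exact: (two_sided_idealMl JI _ vk).
  exact: (two_sided_idealMr JI _ uk).
have Jmax I : two_sided_ideal I -> J `<=` I -> ~ I 1 -> I `<=` J.
  move=> II JIs I1 u Iu; have [k uk] := expand u.
  suff k0 : k = 0 by rewrite k0 scale0r subr0 in uk.
  by apply: (ideal_scalar II I1); apply: (ideal_subl II (JIs _ uk)).
apply/seteqP; split=> [P PJ|P ->]; last first.
  by split; [exact: maximal_ideal_prime|exact: (weight_ideal_bigcap act1 actM Jw)].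
have [Pp _] := PJ; have JP := strat_sub act1 PJ.
apply/seteqP; split=> //.
exact: Jmax (prime_ideal_ideal Pp) JP (prime_ideal1 Pp).
Qed.

End UqB2Strata.

Theorem proposition2p2 (R : realType) (q : R[i]) (q_neq0 : q != 0)
    (q_not_root_of_unity : forall n : nat, (0 < n)%N -> q ^+ n != 1) :
  stratum (ideal_gen [set z q])
    = [set ideal_gen [set z q]]
      `|` [set ideal_gen [set z q; z' q - beta%:A] | beta in [set b : R[i] | b != 0]]
  /\ stratum (ideal_gen [set e3 q]) = [set ideal_gen [set e3 q]]
  /\ stratum (ideal_gen [set e3bar q]) = [set ideal_gen [set e3bar q]]
  /\ stratum (ideal_gen [set e1 q])
    = [set ideal_gen [set e1 q]]
      `|` [set ideal_gen [set e1 q; e2 q - beta%:A] | beta in [set b : R[i] | b != 0]]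
  /\ stratum (ideal_gen [set e2 q])
    = [set ideal_gen [set e2 q]]
      `|` [set ideal_gen [set e1 q - alpha%:A; e2 q] | alpha in [set a : R[i] | a != 0]]
  /\ stratum (ideal_gen [set e1 q; e2 q]) = [set ideal_gen [set e1 q; e2 q]].
Proof.
have HU := UqB2_is_UqB2 q.
pose A h : {lrmorphism UqB2 q -> UqB2 q} := @act _ q h.
have A1 u : A (1, 1) u = u := act1 u.
have AM h k u : A h (A k u) = A (h.1 * k.1, h.2 * k.2) u := actM h k u.
have Ax h : A h (e1 q) = h.1 *: e1 q := act_e1 q h.
have Ay h : A h (e2 q) = h.2 *: e2 q := act_e2 q h.
have aE : e3 q = e1 q * e2 q - q ^+ 2 *: (e2 q * e1 q).
  exact: erefl.
have bE : e3bar q = e1 q * e2 q - q ^- 2 *: (e2 q * e1 q).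
  exact: erefl.
have wE : z q = e2 q * e3 q - q ^+ 2 *: (e3 q * e2 q).
  exact: erefl.
have tE : z' q = (1 - q ^- 2) *: (e3 q * e3bar q + (1 + q ^- 2) *: (z q * e1 q)).
  exact: erefl.
do 5?[split].
- exact: (z_stratum q_neq0 q_not_root_of_unity HU A1 AM Ax Ay aE bE wE tE).
- exact: (e3_stratum q_neq0 q_not_root_of_unity HU A1 AM Ax Ay aE bE wE tE).
- exact: (e3bar_stratum q_neq0 q_not_root_of_unity HU A1 AM Ax Ay aE bE wE tE).
- exact: (e1_stratum HU A1 AM Ax Ay).
- exact: (e2_stratum HU A1 AM Ax Ay).
exact: (e1e2_stratum HU A1 AM Ax Ay).
Qed.
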